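(* Consider the $N$-agent risk-averse game in which agent $i$ solves $\min_{x_i\in\mathcal{X}_i} C_i(x_i,x_{-i})$ with $C_i(x)=\mathrm{CVaR}_{\alpha_i}[J_i(x,\xi_i)]$, $\alpha_i\in(0,1]$, in the setting of the context. Assume the following. (A1) For each agent $i$, the cost function can be decomposed as $J_i(x,\xi_i)=f_i(x_i,\xi_i)+g_i(x)$. Moreover, $f_i(x_i,\xi_i)$ is absolutely continuous and its VaR value is differentiable for any $x_i\in\mathcal{X}_i$. Besides, $f_i(x_i,\xi_i)$ is convex in $x_i$ for every $\xi_i\in\Xi_i$, and, for a constant $m>0$, $\sum_{i}\langle\nabla_i g_i(x)-\nabla_i g_i(x'),x_i-x_i'\rangle\ge m\|x-x'\|^2$ for all $x,x'\in\mathcal{X}$. (A2) $\|\nabla_i J_i(x,\xi_i)\|\le B$ for all $i=1,\dots,N$ (for all $x\in\mathcal{X}$ and $\xi_i\in\Xi_i$). (A3) Let $F_{i,x}(y)=\mathbb{P}\{J_i(x,\xi_i)\le y\}$ and $\mathcal{Y}_{i,x}=\mathrm{Range}(J_i(x,\xi_i))$. For every $x\in\mathcal{X}$, the distribution function $F_{i,x}$ is continuously differentiable and $L_0$-Lipschitz continuous. Moreover, there exists a lower bound $\underline{p}>0$ on its probability density function, i.e., $F_{i,x}'(y)\ge\underline{p}$ for all $y\in\mathcal{Y}_{i,x}$. Let $x^*$ be the (unique) Nash equilibrium of the game, and let $x_1,\dots,x_T$ be the joint actions generated over $T$ episodes by the first-order risk-averse learning algorithm (defined in the context) with step size $\eta=\frac{D}{B}T^{-1/2}$.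 Then, with probability at least $1-\gamma$, $$\frac1T\sum_{t=1}^T\mathbb{E}\|x_t-x^*\|^2=\mathcal{O}\Big(T^{-1/2}\big(S_2(\alpha)+\sqrt{\ln(T/\gamma)}\,S_1(\alpha)\big)\Big),$$ where $S_1(\alpha)=\sum_{i}\frac1{\alpha_i}$ and $S_2(\alpha)=\sum_{i}\frac1{\alpha_i^2}$.
   Context: Setting. There are $N$ agents; agent $i$ chooses an action $x_i$ from a convex set $\mathcal{X}_i\subseteq\mathbb{R}^d$ whose diameter is bounded by $D$. $\mathcal{X}=\prod_{i=1}^N\mathcal{X}_i$, $x=(x_1,\dots,x_N)=(x_i,x_{-i})$, where $x_{-i}$ collects the actions of all agents except $i$. $\xi_i\in\Xi_i\subset\mathbb{R}^{n_\xi}$ is a random variable with a static, unknown distribution; $J_i:\mathcal{X}\times\Xi_i\to\mathbb{R}$ is the stochastic cost, convex in $x_i$ for every $x_{-i}$ and $\xi_i$, and $J_i(\cdot,\xi_i)$ is Lipschitz and differentiable for every $\xi_i$. $\nabla_i$ denotes the partial gradient with respect to $x_i$, and $\|\cdot\|$ is the 2-norm. Risk measures. For a random variable $Z$ with CDF $F$ and $\alpha\in(0,1]$, $\mathrm{VaR}_\alpha[Z]=\mathrm{VaR}_\alpha[F]=\inf\{y:F(y)\ge1-\alpha\}$ is the $1-\alpha$ quantile, and $\mathrm{CVaR}_{\alpha}[Z]=\mathbb{E}[Z\mid Z\ge\mathrm{VaR}_\alpha[Z]]$, which also equals $\min_{\nu\in\mathbb{R}}\{\nu+\frac1\alpha\mathbb{E}[Z-\nu]_+\}$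 with $[z]_+=\max\{z,0\}$. Nash equilibrium. A point $x^*\in\mathcal{X}$ such that $C_i(x^* )\le C_i(x_i,x_{-i}^* )$ for all $x_i\in\mathcal{X}_i$ and all $i=1,\dots,N$. First-order risk-averse learning algorithm. Given an initial value, step size $\eta$, number of episodes $T$ and risk levels $\alpha_i$: at each episode $t=1,\dots,T$, the agents play $x_t=(x_{1,t},\dots,x_{N,t})$; each agent $i$ draws a sample $\xi_i^t$ of $\xi_i$; it evaluates $J_i(x_t,\xi_i^k)$ and $\nabla_iJ_i(x_t,\xi_i^k)$ for $k=1,\dots,t$, forms the empirical distribution function $\hat G_{i,t}(y)=\frac1t\sum_{k=1}^t\mathbf{1}\{J_i(x_t,\xi_i^k)\le y\}$, computes $\nu_{i,t}=\mathrm{VaR}_{\alpha_i}[\hat G_{i,t}]$ and $$g_{i,t}=\frac1{t\alpha_i}\sum_{k=1}^t\mathbf{1}\{J_i(x_t,\xi_i^k)\ge\nu_{i,t}\}\,\nabla_iJ_i(x_t,\xi_i^k),$$ and updates $x_{i,t+1}=\mathcal{P}_{\mathcal{X}_i}(x_{i,t}-\eta g_{i,t})$, where $\mathcal{P}_{\mathcal{X}_i}$ is projection onto $\mathcal{X}_i$. *)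

(* Defs.v *)
From HB Require Import structures.
From mathcomp Require Export all_boot all_order all_algebra.
From mathcomp Require Export all_classical all_reals all_analysis.
Export Order.TTheory GRing.Theory Num.Theory.
Export numFieldNormedType.Exports.

Set Implicit Arguments.
Unset Strict Implicit.
Unset Printing Implicit Defensive.

Local Open Scope classical_set_scope.
Local Open Scope ring_scope.

(* A joint action of N agents with actions in R^d is an N x d matrix whose
   i-th row is the action of agent i.  The library norm on matrices is the
   max norm, hence the separate 2-norm. *)
Definition dotp (R : realType) (m n : nat) (u v : 'M[R]_(m, n)) : R :=
  \sum_i \sum_j u i j * v i j.

Definition norm2 (R : realType) (m n : nat) (u : 'M[R]_(m, n)) : R :=
  Num.sqrt (dotp u u).

Definition joint (R : realType) (N d : nat) (X : 'I_N -> set 'rV[R]_d) :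
    set 'M[R]_(N, d) :=
  [set x | forall i, X i (row i x)].

(* (u, x_{-i}) *)
Definition deviate (R : realType) (N d : nat) (i : 'I_N) (u : 'rV[R]_d)
    (x : 'M[R]_(N, d)) : 'M[R]_(N, d) :=
  \matrix_(k, j) (if k == i then u 0 j else x k j).

Definition pgrad (R : realType) (N d : nat) (i : 'I_N)
    (h : 'M[R]_(N, d) -> R) (x : 'M[R]_(N, d)) : 'rV[R]_d :=
  \row_j 'D_(delta_mx i j) h x.

Definition distr_fun (R : realType) (disp : measure_display)
    (Omega : measurableType disp) (P : probability Omega R)
    (Z : Omega -> R) (y : R) : R :=
  fine (P [set w | Z w <= y]).

(* Extended-real valued, since VaR is -oo at risk level 1. *)
Definition VaR (R : realType) (alpha : R) (F : R -> R) : \bar R :=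
  ereal_inf [set y%:E | y in [set y | 1 - alpha <= F y]].

Definition CVaR (R : realType) (disp : measure_display)
    (Omega : measurableType disp) (P : probability Omega R)
    (alpha : R) (Z : Omega -> R) : R :=
  let tail := [set w | (VaR alpha (distr_fun P Z) <= (Z w)%:E)%E] in
  Rintegral P tail Z / fine (P tail).

Definition nash (R : realType) (N d : nat) (X : 'I_N -> set 'rV[R]_d)
    (Cost : 'I_N -> 'M[R]_(N, d) -> R) (xs : 'M[R]_(N, d)) : Prop :=
  joint X xs /\
  forall i u, X i u -> Cost i xs <= Cost i (deviate i u xs).

Definition mutually_independent (R : realType) (disp : measure_display)
    (Omega : measurableType disp) (P : probability Omega R)
    (disp' : measure_display) (S : measurableType disp')
    (K : {pred nat}) (X : nat -> Omega -> S) : Prop :=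
  forall (r : seq nat) (A : nat -> set S),
    uniq r -> {subset r <= K} -> (forall k, measurable (A k)) ->
    P (\bigcap_(k in [set` r]) (X k @^-1` A k)) =
    (\prod_(k <- r) P (X k @^-1` A k))%E.

(* J, f and g below are total functions; only their values on the action sets
   and on Xi matter, apart from the differentiability (in the ambient space)
   of J and g at boundary points of the action sets. *)
Definition game_setting (R : realType) (N d nxi : nat) (D : R)
    (disp : measure_display) (Omega : measurableType disp)
    (P : probability Omega R)
    (X : 'I_N -> set 'rV[R]_d) (Xi : 'I_N -> set (nxi.-tuple R))
    (xi : 'I_N -> {RV P >-> nxi.-tuple R})
    (J : 'I_N -> 'M[R]_(N, d) -> nxi.-tuple R -> R) : Prop :=
  (forall i, convex_set (X i)) /\
  (forall i u v, X i u -> X i v -> norm2 (u - v) <= D) /\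
  (forall i, measurable (Xi i)) /\
  (forall i w, Xi i (xi i w)) /\
  (forall i x, joint X x -> measurable_fun (Xi i) (J i x)) /\
  (forall i x, joint X x ->
     P.-integrable setT (fun w => (J i x (xi i w))%:E)) /\
  (forall i x z, joint X x -> Xi i z ->
     convex_function (X i) (fun u => J i (deviate i u x) z)) /\
  (forall i z, Xi i z -> [lipschitz J i x z | x in joint X]) /\
  (forall i x z, joint X x -> Xi i z -> differentiable (J i ^~ z) x).

(* Differentiability of the VaR on X i is that of some function extending it;
   at risk level 1, where VaR = -oo, the condition holds trivially. *)
Definition decomposable_monotone (R : realType) (N d nxi : nat) (m : R)
    (disp : measure_display) (Omega : measurableType disp)
    (P : probability Omega R)
    (X : 'I_N -> set 'rV[R]_d) (Xi : 'I_N -> set (nxi.-tuple R))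
    (xi : 'I_N -> {RV P >-> nxi.-tuple R})
    (J : 'I_N -> 'M[R]_(N, d) -> nxi.-tuple R -> R)
    (alpha : 'I_N -> R)
    (f : 'I_N -> 'rV[R]_d -> nxi.-tuple R -> R)
    (g : 'I_N -> 'M[R]_(N, d) -> R) : Prop :=
  (forall i x z, joint X x -> Xi i z ->
     J i x z = f i (row i x) z + g i x) /\
  (forall i u, X i u ->
     pushforward P (fun w => f i u (xi i w)) `<< @lebesgue_measure R) /\
  (forall i, exists V : 'rV[R]_d -> R, forall u, X i u ->
     V u = fine (VaR (alpha i) (distr_fun P (fun w => f i u (xi i w)))) /\
     differentiable V u) /\
  (forall i z, Xi i z -> convex_function (X i) (fun u => f i u z)) /\
  (forall i x, joint X x ->
     differentiable (fun u => g i (deviate i u x)) (row i x)) /\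
  (forall x y, joint X x -> joint X y ->
     m * norm2 (x - y) ^+ 2 <=
     \sum_i dotp (pgrad i (g i) x - pgrad i (g i) y) (row i x - row i y)).

Definition bounded_gradients (R : realType) (N d nxi : nat) (B : R)
    (X : 'I_N -> set 'rV[R]_d) (Xi : 'I_N -> set (nxi.-tuple R))
    (J : 'I_N -> 'M[R]_(N, d) -> nxi.-tuple R -> R) : Prop :=
  forall i x z, joint X x -> Xi i z -> norm2 (pgrad i (J i ^~ z) x) <= B.

(* F is continuously differentiable on Y with density >= p there.  The
   derivative is taken relative to Y, hence one-sided at an end point of an
   interval Y: the density of a random variable with range Y cannot be both
   continuous on the whole line and bounded below by p > 0 on Y. *)
Definition C1_density_ge (R : realType) (Y : set R) (F : R -> R) (p : R) :
    Prop :=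
  exists dF : R -> R,
    (forall y, Y y ->
       (fun z => (F z - F y) / (z - y)) @ within Y y^' --> dF y) /\
    {within Y, continuous dF} /\
    (forall y, Y y -> p <= dF y).

Definition regular_distributions (R : realType) (N d nxi : nat) (L0 p : R)
    (disp : measure_display) (Omega : measurableType disp)
    (P : probability Omega R)
    (X : 'I_N -> set 'rV[R]_d) (Xi : 'I_N -> set (nxi.-tuple R))
    (xi : 'I_N -> {RV P >-> nxi.-tuple R})
    (J : 'I_N -> 'M[R]_(N, d) -> nxi.-tuple R -> R) : Prop :=
  forall i x, joint X x ->
    let F := distr_fun P (fun w => J i x (xi i w)) in
    L0.-lipschitz F /\ C1_density_ge (J i x @` Xi i) F p.

(* The samples of agent i in episodes 1, ..., T are i.i.d. copies of xi i;
   no assumption is made on their dependence across agents. *)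
Definition iid_samples (R : realType) (N nxi : nat)
    (disp : measure_display) (Omega : measurableType disp)
    (P : probability Omega R) (Xi : 'I_N -> set (nxi.-tuple R))
    (xi : 'I_N -> {RV P >-> nxi.-tuple R}) (T : nat)
    (s : 'I_N -> nat -> {RV P >-> nxi.-tuple R}) : Prop :=
  forall i,
    mutually_independent P [pred k | (1 <= k <= T)%N] (fun k => s i k) /\
    forall k, (1 <= k <= T)%N ->
      (forall w, Xi i (s i k w)) /\
      (forall A, measurable A ->
         distribution P (s i k) A = distribution P (xi i) A).

Definition emp_cdf (R : realType) (t : nat) (Z : nat -> R) (y : R) : R :=
  t%:R^-1 * \sum_(1 <= k < t.+1) (Z k <= y)%R%:R.

Definition cvar_grad_est (R : realType) (d : nat) (alpha : R) (t : nat)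
    (Z : nat -> R) (G : nat -> 'rV[R]_d) : 'rV[R]_d :=
  let nu := VaR alpha (emp_cdf t Z) in
  (t%:R * alpha)^-1 *: \sum_(1 <= k < t.+1) (nu <= (Z k)%:E)%E%:R *: G k.

Definition is_projection (R : realType) (d : nat) (A : set 'rV[R]_d)
    (u v : 'rV[R]_d) : Prop :=
  A v /\ forall a, A a -> norm2 (u - v) <= norm2 (u - a).

(* x t is the joint action of episode t = 1, ..., T. *)
Definition risk_averse_run (R : realType) (N d nxi : nat)
    (disp : measure_display) (Omega : measurableType disp)
    (P : probability Omega R) (X : 'I_N -> set 'rV[R]_d)
    (J : 'I_N -> 'M[R]_(N, d) -> nxi.-tuple R -> R)
    (alpha : 'I_N -> R) (eta : R) (T : nat) (x1 : 'M[R]_(N, d))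
    (s : 'I_N -> nat -> {RV P >-> nxi.-tuple R})
    (x : nat -> Omega -> 'M[R]_(N, d)) : Prop :=
  joint X x1 /\
  (forall w, x 1%N w = x1) /\
  (forall t i w, (1 <= t < T)%N ->
     is_projection (X i)
       (row i (x t w) -
        eta *: cvar_grad_est (alpha i) t (fun k => J i (x t w) (s i k w))
                 (fun k => pgrad i (J i ^~ (s i k w)) (x t w)))
       (row i (x t.+1 w))) /\
  (forall t i j, (1 <= t <= T)%N ->
     measurable_fun setT (fun w => x t w i j)).

(* Main.v *)
Require Import Defs.
From mathcomp Require Import ring lra zify measurable_realfun.

Set Implicit Arguments.
Unset Strict Implicit.
Unset Printing Implicit Defensive.

Local Open Scope classical_set_scope.
Local Open Scope ring_scope.

(** Strong monotonicity of the [g_i] bounds [m * |x_t - x*|^2] by the inner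
    product of [x_t - x*] with the exact pseudo-gradient, up to the convex terms
    [CVaR (f_i)], whose gradients never appear: at [x*] a variational inequality
    replaces them, and at [x_t] the subgradient inequality of each sampled cost.
    Projected gradient descent then has regret [O(sqrt T)] up to the bias of the
    empirical tail average.

    Since [x_t] depends on the samples reused in episode [t], the bias must be
    controlled uniformly over the action set.  Each action set is covered by a
    grid of [(T+1)^d] points, and at each grid point finitely many events have
    empirical frequencies within [O(sqrt (ln (T/gamma) / t))] of their
    probabilities (a Chernoff bound and a union bound).  The costs are
    [B]-Lipschitz in the own action, so this transfers to all actions; the dual
    representation of CVaR as a maximum over events of probability [alpha] then
    compares the empirical tail average with the true CVaR. *)

(** * Inner products, segments and directional derivatives *)

(** The cost of an agent depends on the whole joint action, yet a net of its own action set
    suffices: by the decomposition, the other agents shift all sampled costs of agent [i] by one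
    common number, which changes neither the samples selected by the empirical quantile nor
    differences of CVaR. Hence every estimate is made with the opponents frozen at the equilibrium.
    The tail indicator is discontinuous in the action, so the selected samples cannot be carried
    over from a grid point by continuity. They are instead compared with the tail at the grid point
    through a common superset, a slightly larger half-line, whose extra mass the Lipschitz
    distribution function controls. Dividing the bias by [alpha i] produces $S_1$, and the squared
    length of the gradient estimate, at most $(B/\alpha_i)^2$, produces $S_2$. The number of events
    is polynomial in [T], so [N] and [d] enter the logarithm only through a constant factor. The
    bound in expectation is the high-probability bound at $\gamma = 1/T$, the diameter paying for
    the exceptional event. *)

Section inner_product.
Context {R : realType}.

Lemma dotpC m n (u v : 'M[R]_(m, n)) : dotp u v = dotp v u.
Proof. by apply: eq_bigr => i _; apply: eq_bigr => j _; rewrite mulrC. Qed.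

Lemma dotpDl m n (u v w : 'M[R]_(m, n)) : dotp (u + v) w = dotp u w + dotp v w.
Proof.
rewrite -big_split; apply: eq_bigr => i _; rewrite -big_split.
by apply: eq_bigr => j _; rewrite mxE mulrDl.
Qed.

Lemma dotpZl m n a (u v : 'M[R]_(m, n)) : dotp (a *: u) v = a * dotp u v.
Proof.
rewrite mulr_sumr; apply: eq_bigr => i _; rewrite mulr_sumr.
by apply: eq_bigr => j _; rewrite mxE mulrA.
Qed.

Lemma dotpNl m n (u v : 'M[R]_(m, n)) : dotp (- u) v = - dotp u v.
Proof. by rewrite -scaleN1r dotpZl mulN1r. Qed.

Lemma dotpBl m n (u v w : 'M[R]_(m, n)) : dotp (u - v) w = dotp u w - dotp v w.
Proof. by rewrite dotpDl dotpNl. Qed.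

Lemma dotpZr m n a (u v : 'M[R]_(m, n)) : dotp u (a *: v) = a * dotp u v.
Proof. by rewrite dotpC dotpZl dotpC. Qed.

Lemma dotpNr m n (u v : 'M[R]_(m, n)) : dotp u (- v) = - dotp u v.
Proof. by rewrite dotpC dotpNl dotpC. Qed.

Lemma dotpBr m n (u v w : 'M[R]_(m, n)) : dotp w (u - v) = dotp w u - dotp w v.
Proof. by rewrite dotpC dotpBl !(dotpC w). Qed.

Lemma dotp0l m n (v : 'M[R]_(m, n)) : dotp 0 v = 0.
Proof. by rewrite -(scale0r 0) dotpZl mul0r. Qed.

Lemma dotp_suml m n I r (P : pred I) (F : I -> 'M[R]_(m, n)) v :
  dotp (\sum_(k <- r | P k) F k) v = \sum_(k <- r | P k) dotp (F k) v.
Proof.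
by elim/big_rec2: _ => [|k a b _ <-]; rewrite ?dotp0l ?dotpDl.
Qed.

Lemma dotp_ge0 m n (u : 'M[R]_(m, n)) : 0 <= dotp u u.
Proof. by do 2!apply: sumr_ge0 => ? _; rewrite -expr2 sqr_ge0. Qed.

Lemma dotp_row m n (u v : 'M[R]_(m, n)) :
  dotp u v = \sum_i dotp (row i u) (row i v).
Proof.
apply: eq_bigr => i _; rewrite /dotp big_ord1.
by apply: eq_bigr => j _; rewrite !mxE.
Qed.

Lemma norm2_ge0 m n (u : 'M[R]_(m, n)) : 0 <= norm2 u.
Proof. exact: sqrtr_ge0. Qed.

Lemma sqr_norm2 m n (u : 'M[R]_(m, n)) : norm2 u ^+ 2 = dotp u u.
Proof. by rewrite sqr_sqrtr// dotp_ge0. Qed.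

Lemma norm2N m n (u : 'M[R]_(m, n)) : norm2 (- u) = norm2 u.
Proof. by rewrite /norm2 dotpNl dotpNr opprK. Qed.

(** Cauchy-Schwarz: with $c = \langle u,v\rangle$, the squared norm of $cu-\|u\|^2v$ equals
    $\|u\|^2(\|u\|^2\|v\|^2-c^2)$. If $\langle u,u\rangle=0$, positivity of $\|tu-v\|^2$ bounds a
    linear function of [t] from above, so its slope vanishes. *)
Lemma dotp_le_norm2 m n (u v : 'M[R]_(m, n)) : dotp u v <= norm2 u * norm2 v.
Proof.
have [u0|un0] := eqVneq (dotp u u) 0.
  have: forall t, 2 * t * dotp u v <= dotp v v.
    move=> t; have := dotp_ge0 (t *: u - v).
    rewrite dotpBl !dotpBr !dotpZl !dotpZr u0 (dotpC v u); lra.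
  move/(_ ((1 + dotp v v) / (2 * dotp u v))).
  have [->|uv0] := eqVneq (dotp u v) 0; first by rewrite mulr_ge0 ?norm2_ge0.
  rewrite (_ : 2 * _ * _ = 1 + dotp v v); last by field.
  by lra.
have u0 : 0 < norm2 u by rewrite sqrtr_gt0 lt_def un0 dotp_ge0.
have := dotp_ge0 (dotp u v *: u - norm2 u ^+ 2 *: v).
rewrite dotpBl !dotpBr !dotpZl !dotpZr -!sqr_norm2 (dotpC v u) => h.
rewrite (le_trans (ler_norm _))// -(ler_pXn2r (n := 2)) ?nnegrE//; last first.
  by rewrite mulr_ge0 ?norm2_ge0.
rewrite real_normK ?num_real// exprMn -subr_ge0 -(pmulr_rge0 _ (exprn_gt0 2 u0)).
nra.
Qed.

End inner_product.

Section convexity.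
Context {R : realType} {E : lmodType R}.
Implicit Types (A : set E) (u v : E).

Lemma convex_set_segment A u v (s : R) : convex_set A -> A u -> A v ->
  0 <= s <= 1 -> A (u + s *: (v - u)).
Proof.
move=> cA Au Av s01.
have := cA v u (@Itv01 R s (proj1 (andP s01)) (proj2 (andP s01))).
rewrite !inE => /(_ Av Au).
rewrite /conv/= /unstable.onem scalerBl scale1r scalerBr.
by rewrite addrCA.
Qed.

Lemma convex_function_segment A (f : E -> R) u v (s : R) :
  convex_function A f -> A u -> A v -> 0 <= s <= 1 ->
  f (u + s *: (v - u)) <= f u + s * (f v - f u).
Proof.
move=> cf Au Av s01.
have := cf (@Itv01 R s (proj1 (andP s01)) (proj2 (andP s01))) v u.
rewrite !inE => /(_ Av Au).
rewrite /conv/= /unstable.onem scalerBl scale1r scalerBr.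
rewrite addrCA => h.
suff -> : f u + s * (f v - f u) = s * f v + (1 - s) * f u by exact: h.
by ring.
Qed.

End convexity.

Section slopes.
Context {R : realType}.

Lemma slope_differentiable (V : normedModType R) (h : V -> R) (x w : V) :
  differentiable h x ->
  s^-1 * (h (x + s *: w) - h x) @[s --> 0^'] --> 'D_w h x.
Proof.
move=> dh; have := diff_derivable (v := w) dh; rewrite /derivable /derive => dw.
rewrite [X in X @ _ --> _](_ : _ = fun s => s^-1 *: ((h \o shift x) (s *: w) - h x)).
  exact: dw.
by apply/funext => s /=; rewrite [x + _]addrC.
Qed.

Lemma slope_le (q : R -> R) (c l : R) : q s @[s --> 0^'] --> l ->
  (forall s, 0 < s < 1 -> q s <= c) -> l <= c.
Proof.
move=> /cvg_dnbhs_at_right ql qc.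
apply: (cvgr_to_le ql); near=> s; apply: qc; apply/andP; split; near: s.
  exact: nbhs_right_gt.
exact: nbhs_right_lt.
Unshelve. all: by end_near. Qed.

End slopes.

Section joint_actions.
Context {R : realType} {N d : nat}.
Implicit Types (i : 'I_N) (u v w : 'rV[R]_d) (x y : 'M[R]_(N, d)).

Lemma row_deviate i u x : row i (deviate i u x) = u.
Proof. by apply/rowP => j; rewrite !mxE eqxx. Qed.

Lemma row_deviate_neq i k u x : k != i -> row k (deviate i u x) = row k x.
Proof. by move=> ki; apply/rowP => j; rewrite !mxE (negbTE ki). Qed.

Lemma deviate_row i x : deviate i (row i x) x = x.
Proof. by apply/matrixP => k j; rewrite !mxE; case: eqVneq => // ->. Qed.

Lemma deviate_deviate i u v x : deviate i u (deviate i v x) = deviate i u x.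
Proof. by apply/matrixP => k j; rewrite !mxE; case: eqVneq. Qed.

Lemma joint_deviate (X : 'I_N -> set 'rV[R]_d) i u x :
  X i u -> joint X x -> joint X (deviate i u x).
Proof.
move=> Xu Xx k; have [->|ki] := eqVneq k i; first by rewrite row_deviate.
by rewrite row_deviate_neq.
Qed.

Lemma deviate_shift i w x (s : R) :
  deviate i (row i x + s *: w) x = x + s *: \sum_j w 0 j *: delta_mx i j.
Proof.
apply/matrixP => k j; rewrite !mxE summxE.
rewrite (bigD1 j)//= big1 ?addr0 => [|l lj]; rewrite !mxE.
  rewrite eqxx andbT; case: eqVneq => [->|_]; by rewrite ?mulr1 ?mulr0 ?addr0.
by rewrite [j == l]eq_sym (negbTE lj) andbF mulr0.
Qed.

Lemma derive_sum_delta n (h : 'M[R]_(n, d) -> R) (k : 'I_n)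
    (y : 'M[R]_(n, d)) (w : 'rV[R]_d) :
  differentiable h y ->
  'D_(\sum_j w 0 j *: delta_mx k j) h y =
  \sum_j 'D_(delta_mx k j) h y * w 0 j.
Proof.
move=> dh; rewrite deriveE// linear_sum/=; apply: eq_bigr => j _.
by rewrite linearZ/= -deriveE// mulrC.
Qed.

Lemma slope_deviate (h : 'M[R]_(N, d) -> R) i x w : differentiable h x ->
  s^-1 * (h (deviate i (row i x + s *: w) x) - h x) @[s --> 0^'] -->
    dotp (pgrad i h x) w.
Proof.
move=> dh; have := slope_differentiable (w := \sum_j w 0 j *: delta_mx i j) dh.
rewrite derive_sum_delta//.
rewrite [X in _ --> X -> _](_ : _ = dotp (pgrad i h x) w); last first.
  by rewrite /dotp big_ord1; apply: eq_bigr => j _; rewrite mxE.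
by under [X in _ -> X @ _ --> _]eq_fun do rewrite deviate_shift.
Qed.

(** Version for [g i], which is differentiable only in the own action: the derivatives along matrix
    units that define [pgrad] are derivatives of the restriction to row [i]. *)
Lemma slope_deviate_row (h : 'M[R]_(N, d) -> R) i x w :
  differentiable (fun u => h (deviate i u x)) (row i x) ->
  s^-1 * (h (deviate i (row i x + s *: w) x) - h x) @[s --> 0^'] -->
    dotp (pgrad i h x) w.
Proof.
move=> dh; have := slope_differentiable (w := w) dh; rewrite deviate_row.
rewrite (_ : 'D_w _ _ = dotp (pgrad i h x) w)//.
rewrite [w in LHS]row_sum_delta derive_sum_delta//.
rewrite /dotp big_ord1; apply: eq_bigr => j _; rewrite mxE; congr (_ * _).
rewrite /derive; apply: (congr1 (fun q : R -> R => lim (q @ 0^'))); apply/funext => s /=.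
rewrite deviate_row [_ + row i x]addrC deviate_shift.
rewrite [s *: delta_mx i j + x]addrC; congr (_ *: (h (x + s *: _) - _)).
rewrite (bigD1 j)//= big1 ?addr0 => [|l lj]; rewrite mxE !eqxx ?scale1r//=.
by rewrite (negbTE lj) scale0r.
Qed.

End joint_actions.

Section projection.
Context {R : realType} {d : nat}.

(** Minimality of [v] along the segment from [v] to [a] shows that [u - v] and [a - v] do not form
    an acute angle; expanding $\|(u-v)-(a-v)\|^2$ then gives the claim. *)
Lemma projection_nonexpansive (A : set 'rV[R]_d) (u v a : 'rV[R]_d) :
  convex_set A -> is_projection A u v -> A a ->
  norm2 (v - a) ^+ 2 <= norm2 (u - a) ^+ 2.
Proof.
move=> cA [Av vmin] Aa.
have h s : 0 <= s <= 1 ->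
    2 * s * dotp (u - v) (a - v) <= s ^+ 2 * dotp (a - v) (a - v).
  move=> s01; have := vmin _ (convex_set_segment cA Av Aa s01).
  rewrite -[X in is_true X -> _](ler_pXn2r (n := 2)) ?nnegrE ?norm2_ge0//.
  rewrite !sqr_norm2 opprD addrA.
  move: (u - v) (a - v) => b c.
  by rewrite dotpBl !dotpBr !dotpZl !dotpZr (dotpC c b); lra.
have acute : dotp (u - v) (a - v) <= 0.
  rewrite leNgt; apply/negP => c0; move: h.
  have := dotp_ge0 (a - v); move: (dotp (a - v) _) (dotp _ _) c0 => q c c0 q0 h.
  have cq : 0 < c + q by lra.
  (* This [r] is at most 1 and satisfies $rq < c$, whereas minimality at [r] would give $2c\le
     rq$. *)
  set r := c / (c + q); have r0 : 0 < r by rewrite divr_gt0.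
  have rE : r * (c + q) = c by rewrite divfK// gt_eqF.
  have := h r; rewrite (ltW r0) ler_pdivrMr// mul1r lerDl => /(_ q0).
  rewrite (_ : _ * c = r * (2 * c)); last by ring.
  rewrite (_ : _ * q = r * (r * q)); last by ring.
  rewrite ler_pM2l//; nra.
rewrite !sqr_norm2 (_ : u - a = (u - v) - (a - v)); last first.
  by rewrite opprB addrA subrK.
rewrite -(opprB a v) dotpNl dotpNr opprK.
have := dotp_ge0 (u - v); move: (u - v) (a - v) acute => b c bc bb.
rewrite dotpBl !dotpBr (dotpC c b); lra.
Qed.

End projection.

(** * Concentration of empirical frequencies *)

Section concentration.
Context {R : realType} {disp : measure_display} {Omega : measurableType disp}.
Variable P : probability Omega R.

(** From $1-x\le e^{-x}$ one gets $e^x\le 1/(1-x)$, and $(1-x)(1+x+2x^2)=1+x^2(1-2x)\ge1$. *)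
Lemma expR_le_quadratic (x : R) : x <= 2^-1 -> expR x <= 1 + x + 2 * x ^+ 2.
Proof.
move=> x2; have h := expR_ge1Dx (- x).
rewrite expRN in h; have e0 := expR_gt0 x.
have : (1 - x) * expR x <= 1.
  by rewrite -[leRHS](mulVf (lt0r_neq0 e0)) ler_pM2r.
have x1 : 0 < 1 - x by lra.
rewrite mulrC -ler_pdivlMr// => /le_trans; apply.
by rewrite ler_pdivrMr//; nra.
Qed.

Section frequencies.
Variables (K : {pred nat}) (E : nat -> set Omega) (q : R).
Hypothesis mE : forall k, measurable (E k).
Hypothesis independent_E : forall r : seq nat, uniq r -> {subset r <= K} ->
  P (\bigcap_(k in [set` r]) E k) = (\prod_(k <- r) P (E k))%E.
Hypothesis PE : forall k, k \in K -> P (E k) = q%:E.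

(** For $c=e^l-1$ this is $e^{l\cdot\text{count}}$, the exponential of the number of events that
    occur. The product form lets its mean be computed from independence of events alone. *)
Let Y (c : R) (r : seq nat) (w : Omega) : R :=
  \prod_(k <- r) (1 + c * \1_(E k) w).

Let Y_ge0 c r w : 0 <= c -> 0 <= Y c r w.
Proof. by move=> c0; apply: prodr_ge0 => k _; rewrite addr_ge0 ?mulr_ge0. Qed.

Let measurable_Y c r : measurable_fun setT (Y c r).
Proof.
rewrite /Y; elim: r => [|k r IH].
  by under eq_fun do rewrite big_nil; exact: measurable_cst.
under eq_fun do rewrite big_cons; apply: measurable_funM => //.
by apply: measurable_funD => //; apply: measurable_funM.
Qed.

(* The events in [r'] are those already conditioned on: expanding one factor
   of the product moves its index from [r] to [r']. *)
Lemma expectation_prod_indic c r r' : 0 <= c ->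
  uniq (r' ++ r) -> {subset r' ++ r <= K} ->
  (\int[P]_w (\1_(\bigcap_(k in [set` r']) E k) w * Y c r w)%:E =
  (q ^+ size r' * (1 + c * q) ^+ size r)%:E)%E.
Proof.
move=> c0; have mcap (s : seq nat) : measurable (\bigcap_(k in [set` s]) E k).
  by apply: fin_bigcap_measurable => // k _.
elim: r r' => [|k r IH] r' ur sr.
  rewrite cats0 in ur sr; under eq_integral do rewrite /Y big_nil mulr1.
  rewrite integral_indic// setIT mulr1; apply: (etrans (independent_E ur sr)).
  rewrite (eq_big_seq (fun=> q%:E)); last by move=> k /sr; exact: PE.
  by rewrite prodEFin big_const_seq count_predT iter_mulr_1.
have perm_r : perm_eq (k :: r' ++ r) (r' ++ k :: r).
  by rewrite perm_sym -cat1s perm_catCA.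
have ur1 : uniq ((k :: r') ++ r) by rewrite (perm_uniq perm_r).
have sr1 : {subset (k :: r') ++ r <= K}.
  by move=> j; rewrite (perm_mem perm_r); exact: sr.
have ur2 : uniq (r' ++ r) by case/andP : ur1.
have sr2 : {subset r' ++ r <= K} by move=> j jr; apply: sr1; rewrite inE jr orbT.
under eq_integral => w _.
  rewrite {1}/Y big_cons mulrDl mul1r mulrDr -/(Y c r w).
  rewrite [X in _ + X](_ : _ =
      c * (\1_(\bigcap_(k in [set` k :: r']) E k) w * Y c r w)); last first.
    by rewrite !bigcap_seq big_cons indicI/=; ring.
  rewrite EFinD (EFinM c).
  over.
have mf (s : seq nat) : measurable_fun setT
    (fun w => (\1_(\bigcap_(k in [set` s]) E k) w * Y c r w)%:E).
  by apply/measurable_EFinP; apply: measurable_funM.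
have f0 (s : seq nat) w : (0 <= (\1_(\bigcap_(k in [set` s]) E k) w * Y c r w)%:E)%E.
  by rewrite lee_fin mulr_ge0 ?Y_ge0.
rewrite ge0_integralD//=; last 2 first.
- by move=> w _; rewrite mule_ge0.
- exact: measurable_funeM.
rewrite ge0_integralZl_EFin// !IH//= -EFinM -EFinD; congr (_%:E).
by rewrite !exprS; ring.
Qed.

(** Chernoff bound: Markov's inequality for $e^{l\cdot\text{count}}$, whose mean is $(1+cq)^n\le
    e^{ncq}$. *)
Lemma freq_upper_tail (r : seq nat) (delta : R) :
  uniq r -> {subset r <= K} -> 0 <= q <= 1 -> 0 <= delta <= 1 ->
  (P [set w | ((size r)%:R * (q + delta) <= \sum_(k <- r) \1_(E k) w)%R] <=
   (expR (- ((size r)%:R * delta ^+ 2 / 8)))%:E)%E.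
Proof.
move=> ur sr /andP[q0 q1] /andP[d0 d1].
set n := (size r)%:R : R; set S := [set w | _].
(* The exponent is at most $n(2l^2-l\delta)$, which is minimal at $l=\delta/4$ with value
   $-n\delta^2/8$; $\delta\le1$ keeps [l] in the range of [expR_le_quadratic]. *)
pose l := delta / 4; pose c := expR l - 1.
have l0 : 0 <= l by rewrite divr_ge0.
have c0 : 0 <= c by have := expR_ge1Dx l; rewrite /c; lra.
have cl : c <= l + 2 * l ^+ 2.
  have : l <= 2^-1 by rewrite /l; lra.
  by move/expR_le_quadratic; rewrite /c; lra.
have YE w : Y c r w = expR (l * \sum_(k <- r) \1_(E k) w).
  rewrite mulr_sumr expR_sum; apply: eq_bigr => k _.
  rewrite indicE; case: (w \in E k); rewrite ?mulr1 ?mulr0 ?expR0 ?addr0//.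
  by rewrite /c addrCA subrr addr0.
have msum : measurable_fun setT (fun w => \sum_(k <- r) \1_(E k) w : R).
  apply: (@measurable_sum _ _ _ _ _ _ (fun k => \1_(E k))) => k.
  exact: measurable_indic.
have mS : measurable S.
  by rewrite -[S]setTI; exact: measurable_fun_le.
pose a := expR (l * (n * (q + delta))).
have a0 : 0 < a := expR_gt0 _.
have aS : (a%:E * P S <= ((1 + c * q) ^+ size r)%:E)%E.
  have := @expectation_prod_indic c r [::] c0 ur sr.
  rewrite expr0 mul1r => <-.
  have -> : P S = (\int[P]_w (\1_S w)%:E)%E by rewrite integral_indic// setIT.
  rewrite -ge0_integralZl_EFin//; [|by apply/measurable_EFinP|exact: ltW].
  apply: ge0_le_integral => //=.
  - by move=> w _; rewrite -EFinM lee_fin mulr_ge0// ltW.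
  - by apply/measurable_EFinP; apply: measurable_funM.
  - apply/measurable_EFinP; apply: measurable_funM => //.
    by apply: measurable_indic; rewrite bigcap_seq big_nil.
  - move=> w _; rewrite bigcap_seq big_nil indicT mul1r -EFinM lee_fin.
    rewrite indicE; case: (boolP (w \in S)) => wS.
      rewrite mulr1 YE ler_expR ler_wpM2l//.
      by move: wS; rewrite inE.
    by rewrite mulr0 Y_ge0.
rewrite -(@lee_pmul2l _ a%:E)// ?lte_fin// (le_trans aS)// lee_fin /a -expRD.
apply: (@le_trans _ _ (expR (c * q) ^+ size r)).
  by rewrite lerXn2r ?nnegrE ?expR_ge1Dx ?expR_ge0// addr_ge0 ?mulr_ge0.
rewrite -expRM_natl -mulr_natl ler_expR /l -/n.
have n0 : 0 <= n by [].
have : c * q <= l * q + 2 * l ^+ 2.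
  by apply: (@le_trans _ _ ((l + 2 * l ^+ 2) * q)); [rewrite ler_wpM2r|nra].
by rewrite /l => h; rewrite -subr_ge0
  (_ : _ - _ = n * (delta / 4 * q + 2 * (delta / 4) ^+ 2 - c * q));
  [rewrite mulr_ge0// subr_ge0|field].
Qed.

End frequencies.

Lemma measurable_freq_deviation {disp' : measure_display}
    {S : measurableType disp'} (X : nat -> Omega -> S) (A : set S)
    (q delta : R) (t : nat) :
  (forall k, measurable_fun setT (X k)) -> measurable A ->
  measurable [set w | delta <
    `|t%:R^-1 * \sum_(1 <= k < t.+1) \1_A (X k w) - q|].
Proof.
move=> mX mA.
have mf : measurable_fun setT
    (fun w => `|t%:R^-1 * \sum_(1 <= k < t.+1) \1_A (X k w) - q| : R).
  apply: measurableT_comp => //; apply: measurable_funB => //.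
  apply: measurable_funM => //.
  apply: (@measurable_sum _ _ _ _ _ _ (fun k w => \1_A (X k w))) => k.
  apply: measurableT_comp => //; exact: measurable_indic.
rewrite [X in measurable X](_ : _ = ~` (setT `&` [set w |
    `|t%:R^-1 * \sum_(1 <= k < t.+1) \1_A (X k w) - q| <= delta])).
  by apply: measurableC; exact: measurable_fun_le.
rewrite setTI; apply/seteqP.
by split => w /=; rewrite real_ltNge ?num_real// => /negP.
Qed.

Lemma freq_deviation {disp' : measure_display}
    {S : measurableType disp'} (X : nat -> Omega -> S) (K : {pred nat})
    (A : set S) (q delta : R) (t : nat) :
  (forall k, measurable_fun setT (X k)) -> mutually_independent P K X ->
  measurable A -> (forall k, k \in K -> P (X k @^-1` A) = q%:E) ->
  (0 < t)%N -> {subset index_iota 1 t.+1 <= K} -> 0 < delta ->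
  (P [set w | (delta < `|t%:R^-1 * \sum_(1 <= k < t.+1) \1_A (X k w) - q|)%R]
   <= (2 * expR (- (t%:R * delta ^+ 2 / 8)))%:E)%E.
Proof.
move=> mX iX mA PA t0 tK d0.
have mXA (C : set S) k : measurable C -> measurable (X k @^-1` C).
  by move=> mC; rewrite -[X in measurable X]setTI; exact: mX.
have K1 : 1%N \in K by apply: tK; rewrite mem_index_iota.
have q01 : 0 <= q <= 1.
  have : (0 <= P (X 1%N @^-1` A) <= 1)%E.
    by rewrite measure_ge0/= probability_le1//; exact: mXA.
  by rewrite PA.
have tR0 : 0 < t%:R :> R by rewrite ltr0n.
have sumC w : \sum_(1 <= k < t.+1) \1_(~` A) (X k w) =
    t%:R - \sum_(1 <= k < t.+1) \1_A (X k w) :> R.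
  have -> : t%:R = \sum_(1 <= k < t.+1) 1 :> R.
    by rewrite sumr_const_nat subn1.
  rewrite -sumrB; apply: eq_bigr => k _.
  by rewrite indicC indicE; case: (_ \in A); rewrite ?subr0 ?subrr.
have sum_ge0 (C : set S) w : 0 <= \sum_(1 <= k < t.+1) \1_C (X k w) :> R.
  by apply: sumr_ge0.
(* A frequency and a probability differ by at most 1, so the event is empty when [delta] exceeds
   1. *)
have [d1|d1] := leP delta 1; last first.
  rewrite (_ : [set w | _] = set0) ?measure0 ?lee_fin ?mulr_ge0 ?expR_ge0//.
  apply/seteqP; split => // w /=.
  have := sum_ge0 A w; have := sum_ge0 (~` A) w; rewrite sumC.
  move: (\sum_(1 <= k < t.+1) _) => s s1 s0.
  have : 0 <= t%:R^-1 * s <= 1.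
    rewrite mulr_ge0 ?invr_ge0//= ler_pdivrMl//; lra.
  by case/andP: q01 => ? ? /andP[? ?]; rewrite ltr_normr => /orP[|]; lra.
have tail (C : set S) p : measurable C ->
    (forall k, k \in K -> P (X k @^-1` C) = p%:E) -> 0 <= p <= 1 ->
    (P [set w | (t%:R * (p + delta) <= \sum_(1 <= k < t.+1) \1_C (X k w))%R] <=
     (expR (- (t%:R * delta ^+ 2 / 8)))%:E)%E.
  move=> mC PC p01.
  have iC (r : seq nat) : uniq r -> {subset r <= K} ->
      P (\bigcap_(k in [set` r]) (X k @^-1` C)) =
      (\prod_(k <- r) P (X k @^-1` C))%E.
    by move=> ur rK; exact: (iX r (fun=> C)).
  have := @freq_upper_tail K (fun k => X k @^-1` C) p
    (fun k => mXA _ _ mC) iC PC (index_iota 1 t.+1) delta.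
  by rewrite size_iota subn1/= iota_uniq (ltW d0) d1; exact.
have mtail (C : set S) p : measurable C -> measurable
    [set w | t%:R * (p + delta) <= \sum_(1 <= k < t.+1) \1_C (X k w)].
  move=> mC; rewrite -[X in measurable X]setTI; apply: measurable_fun_le => //.
  apply: (@measurable_sum _ _ _ _ _ _ (fun k w => \1_C (X k w))) => k.
  apply: measurableT_comp => //; exact: measurable_indic.
pose U := [set w | t%:R * (q + delta) <= \sum_(1 <= k < t.+1) \1_A (X k w)].
(* The lower tail of the count of [A] is the upper tail of the count of its complement. *)
pose L := [set w | t%:R * (1 - q + delta) <=
                   \sum_(1 <= k < t.+1) \1_(~` A) (X k w)].
apply: (@le_trans _ _ (P (U `|` L))).
  apply: le_measure; rewrite ?inE.
  - exact: measurable_freq_deviation.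
  - by apply: measurableU; apply: mtail => //; exact: measurableC.
  move=> w; rewrite /U /L /= sumC.
  move: (\sum_(1 <= k < t.+1) _) => s.
  rewrite -(@ltr_pM2l _ t%:R)// -[X in X * `|_|](gtr0_norm tR0) -normrM mulrBr.
  rewrite mulrA divff ?gt_eqF// mul1r ltr_normr => /orP[h|h]; [left|right]; lra.
apply: (@le_trans _ _ (P U + P L)%E).
  by apply: measureU2; apply: mtail => //; exact: measurableC.
rewrite mulr_natl mulr2n EFinD leeD//; apply: tail => //.
- exact: measurableC.
- by move=> k kK; rewrite preimage_setC probability_setC ?PA//; exact: mXA.
- by case/andP: q01 => *; apply/andP; split; lra.
Qed.

End concentration.

(** * Value at risk and CVaR *)

Section value_at_risk.
Context {R : realType} {disp : measure_display} {Omega : measurableType disp}.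
Variables (P : probability Omega R) (Z : Omega -> R) (L : R).
Hypothesis mZ : measurable_fun setT Z.
Hypothesis lipschitz_cdf : L.-lipschitz (distr_fun P Z).
Local Notation F := (distr_fun P Z).

Lemma measurable_le_level y : measurable [set w | Z w <= y].
Proof. by rewrite -[X in measurable X]setTI; exact: measurable_fun_le. Qed.

Lemma measurable_ge_level y : measurable [set w | y <= Z w].
Proof. by rewrite -[X in measurable X]setTI; exact: measurable_fun_le. Qed.

Lemma measurable_lt_level y : measurable [set w | Z w < y].
Proof.
rewrite [X in measurable X](_ : _ = ~` [set w | y <= Z w]).
  exact/measurableC/measurable_ge_level.
by apply/seteqP; split => w /=; rewrite real_ltNge ?num_real// => /negP.
Qed.

Lemma distr_funE y : P [set w | Z w <= y] = (F y)%:E.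
Proof. by rewrite fineK// fin_num_measure//; exact: measurable_le_level. Qed.

Lemma distr_fun_ge0 y : 0 <= F y.
Proof. by rewrite -lee_fin -distr_funE. Qed.

Lemma distr_fun_nondecreasing : {homo F : x y / x <= y}.
Proof.
move=> x y xy; rewrite -lee_fin -!distr_funE; apply: le_measure.
- by rewrite inE; exact: measurable_le_level.
- by rewrite inE; exact: measurable_le_level.
- by move=> w /= /le_trans; exact.
Qed.

Lemma distr_fun_lipschitz x y : `|F x - F y| <= L * `|x - y|.
Proof. by have /= := @lipschitz_cdf (x, y) (conj I I). Qed.

Let cdfE : exists X : {RV P >-> R}, cdf X = EFin \o F.
Proof.
pose X : {RV P >-> R} := mfun_Sub (mem_set mZ).
exists X; apply/funext => y /=; rewrite -distr_funE /cdf /distribution /pushforward.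
by congr (P _); apply/seteqP; split => w /=; rewrite in_itv.
Qed.

Lemma distr_fun_gt q : q < 1 -> exists y, q < F y.
Proof.
move=> q1; have [X XE] := cdfE; have := cvg_cdfy1 X; rewrite XE => h.
have : \forall y \near +oo%R, (q%:E < (EFin \o F) y)%E.
  by apply: (h [set x | (q%:E < x)%E]); apply: open_ereal_gt'; rewrite lte_fin.
by move=> /filter_ex[y]; exists y.
Qed.

Lemma distr_fun_lt q : 0 < q -> exists y, F y < q.
Proof.
move=> q0; have [X XE] := cdfE; have := cvg_cdfNy0 X; rewrite XE => h.
have : \forall y \near -oo%R, ((EFin \o F) y < q%:E)%E.
  by apply: (h [set x | (x < q%:E)%E]); apply: open_ereal_lt'; rewrite lte_fin.
by move=> /filter_ex[y]; exists y.
Qed.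

Let L_ge0 : 0 <= L.
Proof.
have := distr_fun_lipschitz 1 0; rewrite subr0 normr1 mulr1.
exact: le_trans (normr_ge0 _).
Qed.

Let le_eps (x y : R) : (forall e, 0 < e -> x <= y + L * e) -> x <= y.
Proof.
move=> h; apply/ler_addgt0Pr => e e0.
have L1 : 0 < L + 1 by rewrite ltr_wpDl.
apply: (le_trans (h (e / (L + 1)) (divr_gt0 e0 L1))).
rewrite lerD2l mulrA ler_pdivrMr//; have := L_ge0; nra.
Qed.

Let distr_fun_shift x e : 0 <= e -> F (x + e) <= F x + L * e.
Proof.
move=> e0; have := distr_fun_lipschitz (x + e) x.
rewrite addrAC subrr add0r (ger0_norm e0) => h.
by rewrite -lerBlDl (le_trans _ h)// ler_norm.
Qed.

(** The limits of the distribution function at both infinities make the infimum finite, and its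
    continuity makes the quantile exact. Hence the tail has probability exactly [a], so that CVaR is
    a tail integral divided by [a]. *)
Lemma VaR_fin a : 0 < a < 1 -> exists v, VaR a F = v%:E /\ F v = 1 - a.
Proof.
move=> /andP[a0 a1]; pose S := [set y | 1 - a <= F y].
have lbS : has_lbound S.
  have [|z Fz] := @distr_fun_lt (1 - a); first by lra.
  exists z => y /= Sy; rewrite leNgt; apply/negP => yz.
  by have := distr_fun_nondecreasing (ltW yz); rewrite /S /= in Sy; lra.
have S0 : S !=set0.
  have [|z Fz] := @distr_fun_gt (1 - a); first by lra.
  by exists z; apply: ltW.
exists (inf S); split; first exact: ereal_inf_EFin.
apply/eqP; rewrite eq_le; apply/andP; split; apply: le_eps => e e0.
  have : ~ S (inf S - e) by move=> /(ge_inf lbS); lra.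
  move/negP; rewrite -ltNge => Fe.
  by have := distr_fun_shift (inf S - e) (ltW e0); rewrite subrK; lra.
have [y Sy yS] := inf_adherent e0 (conj S0 lbS).
apply: (le_trans Sy); apply: (le_trans _ (distr_fun_shift _ (ltW e0))).
by apply: distr_fun_nondecreasing; rewrite ltW.
Qed.

Lemma VaR1 : VaR 1 F = -oo%E.
Proof.
rewrite /VaR subrr -[RHS](@ereal_inf_real R); congr ereal_inf.
apply/seteqP; split => z [y _ <-]; exists y => //=; exact: distr_fun_ge0.
Qed.

Lemma probability_lt_level v : P [set w | Z w < v] = (F v)%:E.
Proof.
have E : P [set w | Z w < v] = (fine (P [set w | Z w < v]))%:E.
  by rewrite fineK// fin_num_measure//; exact: measurable_lt_level.
rewrite E; congr (_%:E); apply/eqP; rewrite eq_le; apply/andP; split.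
  rewrite -lee_fin -E -distr_funE; apply: le_measure; rewrite ?inE.
  - exact: measurable_lt_level.
  - exact: measurable_le_level.
  - by move=> w /ltW.
apply: le_eps => e e0; have := distr_fun_shift (v - e) (ltW e0).
rewrite subrK => /le_trans; apply; rewrite lerD2r -lee_fin -E -distr_funE.
apply: le_measure; rewrite ?inE.
- exact: measurable_le_level.
- exact: measurable_lt_level.
- by move=> w /= h; rewrite (le_lt_trans h)// ltrBlDr ltrDl.
Qed.

Lemma probability_ge_level v : P [set w | v <= Z w] = (1 - F v)%:E.
Proof.
rewrite [X in P X](_ : _ = ~` [set w | Z w < v]).
  rewrite probability_setC ?probability_lt_level//; exact: measurable_lt_level.
by apply/seteqP; split => w /=; rewrite real_leNgt ?num_real// => /negP.
Qed.

Lemma measurable_tail a : 0 < a <= 1 ->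
  measurable [set w | (VaR a F <= (Z w)%:E)%E].
Proof.
rewrite le_eqVlt => /andP[a0 /orP[/eqP ->|a1]].
  rewrite VaR1 [X in measurable X](_ : _ = setT)//.
  by apply/seteqP; split => // w _ /=; rewrite leNye.
have [|v [-> _]] := @VaR_fin a; first by rewrite a0.
by under eq_set do rewrite lee_fin; exact: measurable_ge_level.
Qed.

Lemma probability_tail a : 0 < a <= 1 ->
  P [set w | (VaR a F <= (Z w)%:E)%E] = a%:E.
Proof.
rewrite le_eqVlt => /andP[a0 /orP[/eqP ->|a1]].
  rewrite VaR1 [X in P X](_ : _ = setT) ?probability_setT//.
  by apply/seteqP; split => // w _ /=; rewrite leNye.
have [|v [-> Fv]] := @VaR_fin a; first by rewrite a0.
under eq_set do rewrite lee_fin.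
by rewrite probability_ge_level Fv opprB addrC subrK.
Qed.

Hypothesis iZ : P.-integrable setT (EFin \o Z).

Lemma CVaR_tail a : 0 < a <= 1 ->
  a * CVaR P a Z = \int[P]_(w in [set w | (VaR a F <= (Z w)%:E)%E]) Z w.
Proof.
move=> a01; rewrite /CVaR probability_tail//= mulrC divfK//.
by rewrite gt_eqF//; case/andP: a01.
Qed.

(** The dual representation of CVaR. Subtracting the quantile [v] changes both integrals by the same
    [v * a], and the tail is exactly where [Z - v] is nonnegative, so it maximizes the integral of
    [Z - v]. *)
Lemma CVaR_max a (A : set Omega) : 0 < a <= 1 -> measurable A ->
  P A = a%:E -> \int[P]_(w in A) Z w <= a * CVaR P a Z.
Proof.
move=> a01 mA PA; rewrite CVaR_tail//.
have PT := probability_tail a01; have mT := measurable_tail a01.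
set T := [set w | _] in PT mT *.
have integrableZ (C : set Omega) : measurable C -> P.-integrable C (EFin \o Z).
  by move=> mC; exact: integrableS iZ.
have integrable_cst (C : set Omega) (r : R) : measurable C ->
    P.-integrable C (EFin \o cst r).
  move=> mC; apply: (integrableS (E := setT)) => //.
  exact: finite_measure_integrable_cst.
(* At level 1 the quantile is infinite and cannot be subtracted; there the tail is everything and
   [A] misses only a null set. *)
move: a01; rewrite le_eqVlt => /andP[a0 /orP[/eqP aE|a1]].
  have -> : T = setT.
    by rewrite /T aE VaR1; apply/seteqP; split => // w _ /=; rewrite leNye.
  have PAC : P (~` A) = 0%E by rewrite probability_setC// PA aE subee.
  have -> : \int[P]_w Z w = \int[P]_(w in A) Z w.
    rewrite /Rintegral (negligible_integral (N := ~` A))//.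
    - by rewrite setTD setCK.
    - exact: measurableC.
  by [].
have [|v [vE Fv]] := @VaR_fin a; first by rewrite a0.
have shift (C : set Omega) : measurable C -> P C = a%:E ->
    \int[P]_(w in C) (Z w - v) = \int[P]_(w in C) Z w - v * a.
  move=> mC PC; rewrite RintegralB//; [|exact: integrableZ|exact: integrable_cst].
  by rewrite Rintegral_cst//; have /= -> := PC.
rewrite -(lerD2r (- (v * a))) -!shift//.
rewrite Rintegral_mkcond [leRHS]Rintegral_mkcond.
have iR (C : set Omega) : measurable C ->
    P.-integrable setT (EFin \o ((fun w => Z w - v) \_ C)).
  move=> mC; rewrite -restrict_EFin -integrable_mkcond//.
  have := integrableB mC (integrableZ C mC) (integrable_cst C v mC).
  by apply: eq_integrable => //.
apply: le_Rintegral => //; [exact: iR|exact: iR|].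
move=> w _; rewrite !patchE.
have -> : (w \in T) = (v <= Z w).
  by apply/idP/idP; rewrite inE /T /= vE lee_fin.
have -> : point = 0 :> R by [].
by case: (w \in A); case: (leP v (Z w)) => // h; lra.
Qed.

End value_at_risk.

(** Monotonicity, convexity and translation of CVaR at once: integrate the pointwise bound over the
    tail of [Z], an event that [CVaR_max] admits for [Z0] and [Z1] as well. The case [s = 0] serves
    perturbations of size [c]. *)
Lemma CVaR_le_combination {R : realType} {disp : measure_display}
    {Omega : measurableType disp} (P : probability Omega R) (L a s c : R)
    (Z Z0 Z1 : Omega -> R) :
  P.-integrable setT (EFin \o Z) -> P.-integrable setT (EFin \o Z0) ->
  P.-integrable setT (EFin \o Z1) ->
  L.-lipschitz (distr_fun P Z) -> L.-lipschitz (distr_fun P Z0) ->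
  L.-lipschitz (distr_fun P Z1) -> 0 < a <= 1 -> 0 <= s <= 1 ->
  (forall w, Z w <= (1 - s) * Z0 w + s * Z1 w + c) ->
  CVaR P a Z <= (1 - s) * CVaR P a Z0 + s * CVaR P a Z1 + c.
Proof.
move=> iZ iZ0 iZ1 lZ lZ0 lZ1 a01 /andP[s0 s1] le_Z.
have mint Y : P.-integrable setT (EFin \o Y) -> measurable_fun setT Y.
  by move=> /integrableP[/measurable_EFinP].
have a0 : 0 < a by case/andP: a01.
have mT := measurable_tail (mint _ iZ) lZ a01.
have PT := probability_tail (mint _ iZ) lZ a01.
rewrite -(ler_pM2l a0) (CVaR_tail (mint _ iZ) lZ a01).
set T := [set w | _] in mT PT *.
have iT Y : P.-integrable setT (EFin \o Y) -> P.-integrable T (EFin \o Y).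
  exact: integrableS.
have iTM (r : R) Y : P.-integrable T (EFin \o Y) ->
    P.-integrable T (EFin \o (fun w => r * Y w)).
  by move=> iY; have := integrableZl mT r iY.
have ic : P.-integrable T (EFin \o (fun=> c)).
  by apply: (integrableS (E := setT)) => //; exact: finite_measure_integrable_cst.
have iTD Y Y' : P.-integrable T (EFin \o Y) -> P.-integrable T (EFin \o Y') ->
    P.-integrable T (EFin \o (fun w => Y w + Y' w)).
  by move=> iY iY'; have := integrableD mT iY iY'.
have h0 := CVaR_max (mint _ iZ0) lZ0 iZ0 a01 mT PT.
have h1 := CVaR_max (mint _ iZ1) lZ1 iZ1 a01 mT PT.
have i0 := iTM (1 - s) _ (iT _ iZ0); have i1 := iTM s _ (iT _ iZ1).
have i01 := iTD _ _ i0 i1.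
apply: (@le_trans _ _
    (\int[P]_(w in T) ((1 - s) * Z0 w + s * Z1 w + c))).
  by apply: le_Rintegral => //; [exact: iT|exact: iTD i01 ic].
rewrite (RintegralD mT i01 ic) (RintegralD mT i0 i1).
rewrite (RintegralZl (1 - s) mT (iT _ iZ0)) (RintegralZl s mT (iT _ iZ1)).
rewrite Rintegral_cst//; have /= -> := PT.
move: h0 h1; move: (\int[P]_(w in T) Z0 w) (\int[P]_(w in T) Z1 w) => I0 I1 h0 h1.
have := ler_wpM2l s0 h1; have : 0 <= 1 - s by lra.
by move=> s1' h1'; have := ler_wpM2l s1' h0; rewrite /fine; lra.
Qed.

(** * The empirical tail average of one agent *)

Section empirical_quantile.
Context {R : realType}.
Implicit Types (Z : nat -> R) (a : R).

Lemma emp_cdf_nondecreasing t Z : {homo emp_cdf t Z : x y / x <= y}.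
Proof.
move=> x y xy; rewrite /emp_cdf ler_wpM2l ?invr_ge0// ler_sum// => k _.
by rewrite ler_nat; case: (leP (Z k) x) => // /le_trans/(_ xy) ->.
Qed.

Lemma VaR_emp_ge t Z a y : emp_cdf t Z y < 1 - a ->
  (y%:E <= VaR a (emp_cdf t Z))%E.
Proof.
move=> Fy; apply: le_ereal_inf_tmp => _ [x /= Fx <-].
rewrite lee_fin leNgt; apply/negP => /ltW/(@emp_cdf_nondecreasing t Z) Fxy.
by have := lt_le_trans (le_lt_trans Fxy Fy) Fx; rewrite ltxx.
Qed.

(** Otherwise more than $t(1-a)$ samples lie strictly below the quantile; the largest of them
    already has empirical distribution function at least $1-a$, so the infimum defining the quantile
    cannot exceed it. *)
Lemma emp_tail_ge t Z a : (0 < t)%N -> a <= 1 ->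
  t%:R * a <= \sum_(1 <= k < t.+1) (VaR a (emp_cdf t Z) <= (Z k)%:E)%E%:R.
Proof.
move=> t0 a1; set nu := VaR _ _; rewrite leNgt; apply/negP => few.
have tR0 : 0 < t%:R :> R by rewrite ltr0n.
pose below k := ((Z k)%:E < nu)%E.
have belowE : \sum_(1 <= k < t.+1) (below k)%:R =
    t%:R - \sum_(1 <= k < t.+1) (nu <= (Z k)%:E)%E%:R :> R.
  have -> : t%:R = \sum_(1 <= k < t.+1) 1 :> R by rewrite sumr_const_nat subn1.
  rewrite -sumrB; apply: eq_bigr => k _.
  by rewrite /below; case: leP => _; rewrite ?subrr ?subr0.
have many : t%:R * (1 - a) < \sum_(1 <= k < t.+1) (below k)%:R.
  by rewrite belowE; lra.
have [k0 bk0 k0max] : exists2 k0, below k0 &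
    forall k, (1 <= k < t.+1)%N -> below k -> Z k <= Z k0.
  have [i0 bi0] : exists i0 : 'I_t, below i0.+1.
    apply/existsP; apply: contraLR many => /existsPn nb.
    rewrite -leNgt big_nat big1 ?mulr_ge0 ?subr_ge0// => k /andP[k1 kt].
    have kt' : (k.-1 < t)%N by rewrite prednK// -ltnS.
    by have := nb (Ordinal kt'); rewrite /= prednK// => /negbTE ->.
  case: (@Order.TotalTheory.arg_maxP _ _ _ i0 (fun i : 'I_t => below i.+1)
           (fun i => Z i.+1) bi0) => j bj jmax.
  exists j.+1 => // k /andP[k1 kt] bk.
  have kt' : (k.-1 < t)%N by rewrite prednK// -ltnS.
  by have := jmax (Ordinal kt'); rewrite /= prednK//; exact.
have : (nu <= (Z k0)%:E)%E.
  apply: ereal_inf_lbound; exists (Z k0) => //=.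
  rewrite /emp_cdf mulrC ler_pdivlMr// mulrC (le_trans (ltW many))//.
  rewrite [leLHS]big_nat [leRHS]big_nat ler_sum// => k kt.
  by rewrite ler_nat; case: (boolP (below k)) => // /(k0max _ kt) ->.
by rewrite leNgt => /negP; apply.
Qed.

End empirical_quantile.

Section layers.
Context {R : realType}.

(** Layer-cake approximation: counting the levels $1,\dots,n$ below [y] recovers [y] up to 1. With
    the next lemma it reduces averages of a bounded function to frequencies of [n] superlevel
    sets. *)
Lemma sum_levels_le (n : nat) (y : R) : 0 <= y ->
  \sum_(l < n) (l.+1%:R <= y)%R%:R <= y.
Proof.
move=> y0; elim: n => [|n IH]; first by rewrite big_ord0.
rewrite big_ord_recr/=; case: (leP n.+1%:R y) => ny; last by rewrite addr0.
apply: le_trans ny; rewrite -natr1 lerD2r.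
apply: (@le_trans _ _ (\sum_(l < n) 1)); last by rewrite sumr_const card_ord.
by apply: ler_sum => l _; case: (leP l.+1%:R y).
Qed.

Lemma sum_levels_ge (n : nat) (y : R) : y <= n.+1%:R ->
  y <= \sum_(l < n) (l.+1%:R <= y)%R%:R + 1.
Proof.
elim: n => [|n IH] yn; first by rewrite big_ord0 add0r.
rewrite big_ord_recr/=; case: (leP n.+1%:R y) => ny; last by rewrite addr0 IH// ltW.
rewrite (le_trans yn)// -(natr1 n.+1) lerD2r -(natr1 n) lerD2r.
rewrite -[leLHS](_ : \sum_(l < n) 1 = _); last by rewrite sumr_const card_ord.
apply: ler_sum => l _; rewrite (_ : _ <= y)// (le_trans _ ny)// ler_nat.
by rewrite ltnS ltnW.
Qed.

End layers.

Lemma Rintegral_sum {R : realType} {disp : measure_display}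
    {T : measurableType disp} (mu : {measure set T -> \bar R}) (D : set T)
    (I : Type) (s : seq I) (f : I -> T -> R) :
  measurable D -> (forall i, mu.-integrable D (EFin \o f i)) ->
  mu.-integrable D (EFin \o (fun x => \sum_(i <- s) f i x)) /\
  \int[mu]_(x in D) (\sum_(i <- s) f i x) =
  \sum_(i <- s) \int[mu]_(x in D) f i x.
Proof.
move=> mD fi; elim: s => [|i s [IH IHs]].
  under [X in EFin \o X]eq_fun do rewrite big_nil.
  under eq_Rintegral do rewrite big_nil.
  rewrite big_nil Rintegral_cst// mul0r; split => //.
  exact: integrable0.
under [X in EFin \o X]eq_fun do rewrite big_cons.
under eq_Rintegral do rewrite big_cons.
rewrite big_cons (RintegralD mD (fi i) IH) IHs; split => //.
by have := integrableD mD (fi i) IH.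
Qed.

(* The finitely many events of one agent, one episode and one point of the net
   whose empirical frequencies have to be close to their probabilities: the
   superlevel sets of [tail * (h - h0 + M) / (2 * M)], the tail itself, and two
   half-lines that locate the empirical quantile. *)
Definition test_event {R : realType} {disp disp' : measure_display}
    {Omega : measurableType disp} (P : probability Omega R)
    {S : measurableType disp'} (xi : Omega -> S) (Xi : set S)
    (a M eps delta : R) (n : nat) (h h0 : S -> R)
    (ty : ('I_n + option bool)%type) : set S :=
  let F := distr_fun P (h \o xi) in
  let tail := [set z | (VaR a F <= (h z)%:E)%E] in
  let nu := fine (VaR (a + 2 * delta) F) in
  Xi `&` match ty with
         | inl l =>
             tail `&` [set z | l.+1%:R <= n%:R * ((h z - h0 z + M) / (2 * M))]
         | inr None => tail
         | inr (Some true) => [set z | h z <= nu]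
         | inr (Some false) => [set z | nu - 2 * eps <= h z]
         end.

(** * Tail averages of one agent's samples against CVaR, near one net point *)

Section one_agent.
Context {R : realType} {disp disp' : measure_display}.
Context {Omega : measurableType disp} (P : probability Omega R).
Context {S : measurableType disp'}.
Variables (xi : Omega -> S) (Xi : set S) (L a M eps delta : R) (n : nat).
Variables (h h0 : S -> R).
Hypothesis mXi : measurable Xi.
Hypothesis mh : measurable_fun Xi h.
Hypothesis mh0 : measurable_fun Xi h0.
Local Notation test := (@test_event _ _ _ _ P _ xi Xi a M eps delta n h h0).

Lemma measurable_test_event ty : measurable (test ty).
Proof.
have ge_level c : measurable (Xi `&` [set z | c <= h z]).
  by apply: measurable_fun_le => //; exact: measurable_cst.
have mtail : measurable (Xi `&`
    [set z | (VaR a (distr_fun P (h \o xi)) <= (h z)%:E)%E]).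
  case: (VaR _ _) => [v||].
  - by under eq_set do rewrite lee_fin; exact: ge_level.
  - under eq_set do rewrite leye_eq/=.
    by rewrite (_ : [set _ | _] = set0) ?setI0//; apply/seteqP; split.
  - under eq_set do rewrite leNye.
    by rewrite (_ : [set _ | _] = setT) ?setIT//; apply/seteqP; split.
case: ty => [l|[[]|]]; rewrite /test_event//=.
- rewrite setIIr; apply: measurableI => //.
  apply: measurable_fun_le => //.
  apply: measurable_funM => //; apply: measurable_funM => //.
  by apply: measurable_funD => //; exact: measurable_funB.
- by apply: measurable_fun_le => //; exact: measurable_cst.
Qed.

Hypothesis xi_Xi : forall w, Xi (xi w).
Hypothesis mxi : measurable_fun setT xi.
Hypothesis ih : P.-integrable setT (EFin \o (h \o xi)).
Hypothesis ih0 : P.-integrable setT (EFin \o (h0 \o xi)).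
Hypothesis lh : L.-lipschitz (distr_fun P (h \o xi)).
Hypothesis lh0 : L.-lipschitz (distr_fun P (h0 \o xi)).
Hypothesis a01 : 0 < a <= 1.
Hypothesis M_gt0 : 0 < M.
Hypothesis delta_gt0 : 0 < delta.
Hypothesis n_gt0 : (0 < n)%N.
Hypothesis n_delta : n%:R^-1 <= delta.
Hypothesis le_hh0 : forall z, Xi z -> `|h z - h0 z| <= M.

Variables (t : nat) (z : nat -> S).
Hypothesis t_gt0 : (0 < t)%N.
Hypothesis z_Xi : forall k, (1 <= k < t.+1)%N -> Xi (z k).

Let avg (u : nat -> R) := t%:R^-1 * \sum_(1 <= k < t.+1) u k.

Hypothesis good : forall ty,
  `|avg (fun k => \1_(test ty) (z k)) - fine (P (xi @^-1` test ty))| <= delta.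

Let a_gt0 : 0 < a. Proof. by case/andP: a01. Qed.

Let tR_gt0 : 0 < t%:R :> R. Proof. by rewrite ltr0n. Qed.

Let avg_le u v : (forall k, (1 <= k < t.+1)%N -> u k <= v k) -> avg u <= avg v.
Proof.
move=> uv; rewrite /avg ler_wpM2l ?invr_ge0// big_nat [leRHS]big_nat.
exact: ler_sum.
Qed.

Let avgD u v : avg (fun k => u k + v k) = avg u + avg v.
Proof. by rewrite /avg big_split mulrDr. Qed.

Let avgB u v : avg (fun k => u k - v k) = avg u - avg v.
Proof. by rewrite /avg sumrB mulrBr. Qed.

Let avgZ c u : avg (fun k => c * u k) = c * avg u.
Proof. by rewrite /avg -mulr_sumr mulrCA. Qed.

Let avg_cst c : avg (fun=> c) = c.
Proof.
by rewrite /avg sumr_const_nat subn1/= -[c *+ t]mulr_natl mulrA mulVf ?mul1r// gt_eqF.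
Qed.

Let mZ (Y : Omega -> R) :
  P.-integrable setT (EFin \o Y) -> measurable_fun setT Y.
Proof. by move=> /integrableP[/measurable_EFinP]. Qed.

Let T : set Omega := xi @^-1` test (inr None).

Let TE : T = [set w | (VaR a (distr_fun P (h \o xi)) <= ((h \o xi) w)%:E)%E].
Proof. by apply/seteqP; split => w /=; [case|split]. Qed.

Let mT : measurable T.
Proof. by rewrite TE; exact: (measurable_tail (mZ ih) lh a01). Qed.

Let PT : P T = a%:E.
Proof. by rewrite TE; exact: (probability_tail (mZ ih) lh a01). Qed.

(** The true tail of [h] computes the CVaR of [h] exactly and bounds that of [h0] from the
    favourable side by [CVaR_max]. Passing to the samples costs, after rescaling by $2M$, one
    [delta] for the level frequencies and one for rounding to [n] levels; centring by [M] adds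
    $M\delta$ from the tail frequency, in total $5M\delta$. *)
Lemma avg_tail_ge : a * (CVaR P a (h \o xi) - CVaR P a (h0 \o xi)) -
  5 * M * delta <= avg (fun k => \1_(test (inr None)) (z k) * (h (z k) - h0 (z k))).
Proof.
pose y s := (h s - h0 s + M) / (2 * M).
have M2 : 0 < 2 * M by rewrite mulr_gt0.
have y01 s : Xi s -> 0 <= y s <= 1.
  move=> /le_hh0; rewrite ler_norml /y => /andP[? ?].
  apply/andP; split; last by rewrite ler_pdivrMr//; lra.
  by apply: divr_ge0; [lra|exact: ltW].
have nR : 0 < n%:R :> R by rewrite ltr0n.
have iT Y : P.-integrable setT (EFin \o Y) -> P.-integrable T (EFin \o Y).
  exact: integrableS.
have idiff : P.-integrable T (EFin \o (fun w => h (xi w) - h0 (xi w))).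
  by have := integrableB mT (iT _ ih) (iT _ ih0).
have icst (c : R) : P.-integrable T (EFin \o cst c).
  by apply: iT; exact: finite_measure_integrable_cst.
have iy : P.-integrable T (EFin \o (fun w => n%:R * y (xi w))).
  have := integrableZl mT (n%:R / (2 * M)) (integrableD mT idiff (icst M)).
  apply: eq_integrable => // w _ /=.
  by rewrite -EFinD -EFinM /y; congr (_%:E); field; rewrite gt_eqF.
have mtest l : measurable (xi @^-1` test (inl l)).
  rewrite -[X in measurable X]setTI.
  by apply: mxi => //; exact: measurable_test_event.
have test_sub l : test (inl l) `<=` test (inr None).
  by move=> s [Xs [ts _]]; split.
have indE l s : test (inr None) s ->
    \1_(test (inl l)) s = (l.+1%:R <= n%:R * y s)%R%:R :> R.
  move=> [Xs ts]; rewrite indicE; congr (nat_of_bool _)%:R.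
  apply/idP/idP; first by rewrite inE => -[_ []].
  by move=> ls; rewrite inE; do !split.
have iind l : P.-integrable T (EFin \o (fun w => \1_(test (inl l)) (xi w))).
  by apply: iT; exact: (integrable_indic P (mtest l)).
have Iind l : \int[P]_(w in T) \1_(test (inl l)) (xi w) =
    fine (P (xi @^-1` test (inl l))).
  rewrite /Rintegral; congr fine.
  rewrite (integral_indic P mT (mtest l)); congr (P _).
  by apply/setIidPl => w; exact: test_sub.
have [isum Isum] := Rintegral_sum (index_enum 'I_n) mT iind.
have Iy : \int[P]_(w in T) (n%:R * y (xi w)) = n%:R / (2 * M) *
    (\int[P]_(w in T) (h (xi w) - h0 (xi w)) + M * a).
  rewrite -[X in M * X](_ : fine (P T) = a); last by rewrite PT.
  rewrite -(Rintegral_cst P mT) -(RintegralD mT idiff (icst M)).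
  rewrite -(RintegralZl (n%:R / (2 * M)) mT (integrableD mT idiff (icst M))).
  by apply: eq_Rintegral => w _; rewrite /y /cst/=; field; rewrite gt_eqF.
have upper : \int[P]_(w in T) (n%:R * y (xi w)) <=
    \sum_(l < n) fine (P (xi @^-1` test (inl l))) + a.
  rewrite -(eq_bigr _ (fun l _ => Iind l)) -Isum.
  rewrite -[X in _ + X](_ : fine (P T) = a); last by rewrite PT.
  rewrite -[fine (P T)]mul1r -(Rintegral_cst P mT) -(RintegralD mT isum (icst 1)).
  apply: le_Rintegral => //.
    by have := integrableD mT isum (icst 1).
  move=> w Tw; rewrite (eq_bigr _ (fun l _ => indE l _ Tw)).
  apply: sum_levels_ge; rewrite -natr1; have /andP[_ y1] := y01 _ (xi_Xi w).
  by rewrite (@le_trans _ _ n%:R) ?lerDl// ler_piMr.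
have lower : \sum_(l < n) avg (fun k => \1_(test (inl l)) (z k)) <=
    n%:R * avg (fun k => \1_(test (inr None)) (z k) * y (z k)).
  rewrite /avg -mulr_sumr exchange_big/= mulrCA [X in _ <= _ * X]mulr_sumr.
  rewrite ler_wpM2l ?invr_ge0// big_nat [leRHS]big_nat ler_sum// => k kt.
  have /andP[y0 _] := y01 _ (z_Xi kt).
  rewrite [\1_(test (inr None)) _]indicE.
  case: (boolP (z k \in test (inr None))) => Tz.
    rewrite mul1r; move: Tz; rewrite inE => Tz.
    rewrite (eq_bigr _ (fun l _ => indE l _ Tz)).
    by apply: sum_levels_le; rewrite mulr_ge0.
  rewrite notin_setE in Tz.
  by rewrite mul0r mulr0 big1// => l _; rewrite indicE memNset// => /test_sub.
have close : \sum_(l < n) fine (P (xi @^-1` test (inl l))) - n%:R * delta <=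
    \sum_(l < n) avg (fun k => \1_(test (inl l)) (z k)).
  rewrite -[n in n%:R]card_ord mulr_natl -sumr_const -sumrB ler_sum// => l _.
  by have := good (inl l); rewrite ler_norml => /andP[+ _]; lra.
have goodT : avg (fun k => \1_(test (inr None)) (z k)) <= a + delta.
  have := good (inr None); rewrite PT /= ler_norml => /andP[_]; lra.
have CV : a * (CVaR P a (h \o xi) - CVaR P a (h0 \o xi)) <=
    \int[P]_(w in T) (h (xi w) - h0 (xi w)).
  rewrite (RintegralB mT (iT _ ih) (iT _ ih0)) mulrBr.
  rewrite (CVaR_tail (mZ ih) lh a01) -TE.
  by rewrite lerD2l lerN2 (CVaR_max (mZ ih0) lh0 ih0 a01 mT PT).
have -> : avg (fun k => \1_(test (inr None)) (z k) * (h (z k) - h0 (z k))) =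
    2 * M * avg (fun k => \1_(test (inr None)) (z k) * y (z k)) -
    M * avg (fun k => \1_(test (inr None)) (z k)).
  rewrite -!avgZ -avgB; congr (_ * _); apply: eq_bigr => k _.
  by rewrite /y; field; rewrite gt_eqF.
rewrite Iy in upper; move: upper lower close goodT CV.
move: (\int[P]_(w in T) _) (\sum_(l < n) fine _) (\sum_(l < n) avg _).
move: (CVaR P a _ - _) => c I s1 s2.
set u := avg (fun k => _ * y (z k)); set v := avg (fun k => \1_(test (inr None)) _).
move=> upper lower close vle cI.
have a1 : a <= 1 by case/andP: a01.
have key : n%:R * (I + M * a) <= n%:R * (2 * M * u + 2 * M * (2 * delta)).
  have h1 : n%:R / (2 * M) * (I + M * a) <= n%:R * u + n%:R * delta + 1 by lra.
  have h2 : 1 <= n%:R * delta by rewrite -ler_pdivrMl// mulr1.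
  have h3 : n%:R / (2 * M) * (I + M * a) <= n%:R * (u + 2 * delta) by lra.
  have := ler_wpM2l (ltW M2) h3.
  rewrite (_ : 2 * M * (_ / _ * _) = n%:R * (I + M * a)); last first.
    by field; rewrite gt_eqF.
  by move=> /le_trans; apply; rewrite le_eqVlt; apply/orP; left; apply/eqP; ring.
rewrite ler_pM2l// in key.
by have := ler_wpM2l (ltW M_gt0) vle; lra.
Qed.

Variables (hu : S -> R) (b : R).
Hypothesis ihu : P.-integrable setT (EFin \o (hu \o xi)).
Hypothesis lhu : L.-lipschitz (distr_fun P (hu \o xi)).
Hypothesis eps_ge0 : 0 <= eps.
Hypothesis le_huh : forall z, Xi z -> `|hu z - h z| <= eps.
Hypothesis le_huh0 : forall z, Xi z -> `|hu z - h0 z| <= M.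

(** Excess mass of the common half-line: $2\delta$ from the quantile level [a + 2 * delta],
    $2\epsilon L$ from lowering the quantile by $2\epsilon$, and one more [delta] for the empirical
    frequency. *)
Let rho := 3 * delta + 2 * eps * L.
(** [hu] is the cost at the actual action, [h] at the nearby net point, and [b] the shift caused by
    the opponents. Below, [q] is the weight used by the algorithm and [r] the true tail at the net
    point. *)
Let J k := hu (z k) + b.
Let q k : R := (VaR a (emp_cdf t J) <= (J k)%:E)%E%:R.
Let r k : R := \1_(test (inr None)) (z k).

Let L_ge0 : 0 <= L.
Proof.
have := distr_fun_lipschitz lh 1 0; rewrite subr0 normr1 mulr1.
exact: le_trans (normr_ge0 _).
Qed.

Let rho_ge : 2 * delta <= rho.
Proof.
have : 0 <= 2 * eps * L by rewrite mulr_ge0// mulr_ge0.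
by have := delta_gt0; rewrite /rho; lra.
Qed.

(* Both the samples above the empirical quantile at [hu] and those above the
   true quantile at [h] lie in a half-line slightly larger than the tail. *)
Let common_cap : exists p : nat -> R,
  (forall k, (1 <= k < t.+1)%N -> q k <= p k /\ r k <= p k) /\
  avg p <= a + rho.
Proof.
(* [VaR_fin] needs a level below 1; beyond it the constant 1 is a cap, as $1\le a+2\delta\le
   a+\rho$. *)
have [a1|a1] := leP 1 (a + 2 * delta).
  exists (fun=> 1); split; last by rewrite avg_cst; have := rho_ge; lra.
  by move=> k _; rewrite /q /r indicE !lern1 !leq_b1.
have [|v [vE Fv]] := @VaR_fin _ _ _ P _ _ (mZ ih) lh (a + 2 * delta).
  by rewrite a1 andbT addr_gt0// mulr_gt0.
have nuE : fine (VaR (a + 2 * delta) (distr_fun P (h \o xi))) = v by rewrite vE.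
exists (fun k => \1_(test (inr (Some false))) (z k)); split => [k kt|].
  have Xk := z_Xi kt.
  suff [qk rk] : ((VaR a (emp_cdf t J) <= (J k)%:E)%E -> v - 2 * eps <= h (z k))
      /\ (z k \in test (inr None) -> v - 2 * eps <= h (z k)).
    have inE' : v - 2 * eps <= h (z k) -> z k \in test (inr (Some false)).
      by move=> vh; rewrite inE; split => //=; rewrite nuE.
    rewrite /q /r !indicE; split.
      by case: (boolP (VaR a (emp_cdf t J) <= (J k)%:E)%E) => // /qk/inE' ->.
    by case: (boolP (_ \in test (inr None))) => // /rk/inE' ->.
  split.
    (* A sampled cost at most [v - eps + b] forces [h <= v], an event of probability $1-a-2\delta$
       and so of frequency at most $1-a-\delta$. The second [delta] makes this strictly less than
       $1-a$, as [VaR_emp_ge] requires. *)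
    have : ((v - eps + b)%:E <= VaR a (emp_cdf t J))%E.
      apply: VaR_emp_ge.
      have : emp_cdf t J (v - eps + b) <=
          avg (fun k => \1_(test (inr (Some true))) (z k)).
        apply: avg_le => l lt'; rewrite indicE ler_nat.
        case: (leP (J l) _) => // Jl; rewrite mem_set//; split; first exact: z_Xi.
        rewrite /= nuE; move: Jl; rewrite /J lerD2r => Jl.
        by have := le_huh (z_Xi lt'); rewrite ler_norml => /andP[+ _]; lra.
      have := good (inr (Some true)); rewrite [X in fine (P X)](_ : _ =
        [set w | (h \o xi) w <= v]); last first.
        apply/seteqP; split => w; rewrite /test_event/= nuE; first by case.
        by split.
      rewrite (distr_funE P (mZ ih)) /= ler_norml Fv => /andP[_].
      by have := delta_gt0; lra.
    move=> /le_trans/[apply]; rewrite lee_fin /J lerD2r => vh.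
    by have := le_huh Xk; rewrite ler_norml => /andP[_]; lra.
  rewrite inE => -[_ /= /(le_trans _)]; rewrite -lee_fin; apply.
  apply: (@le_trans _ _ v%:E); first by rewrite lee_fin gerBl mulr_ge0.
  apply: le_ereal_inf_tmp => _ [y /= Fy <-]; rewrite lee_fin leNgt; apply/negP.
  move=> /ltW/(distr_fun_nondecreasing P (mZ ih)); have := delta_gt0.
  by move: Fy; rewrite Fv; lra.
have := good (inr (Some false)); rewrite [X in fine (P X)](_ : _ =
  [set w | v - 2 * eps <= (h \o xi) w]); last first.
  by apply/seteqP; split => w; rewrite /test_event/= nuE; [case|split].
rewrite (probability_ge_level (mZ ih) lh)/= ler_norml => /andP[_].
have := distr_fun_lipschitz lh v (v - 2 * eps); rewrite Fv ler_norml.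
rewrite opprB addrC subrK ger0_norm ?mulr_ge0// => /andP[_].
by rewrite /rho; lra.
Qed.

Lemma avg_quantile_weight : a <= avg q <= a + rho.
Proof.
have [p [pqr pa]] := common_cap; apply/andP; split.
  have /andP[_ a1] := a01; have := emp_tail_ge J t_gt0 a1.
  by rewrite mulrC -ler_pdivlMr// mulrC.
by apply: le_trans pa; apply: avg_le => k /pqr[].
Qed.

(** Exchanging the weights [q] for [r] costs at most [M] times the average of $(p-q)+(p-r)$ for the
    common cap [p], that is $M(2\rho+\delta)$. Exchanging [hu] for [h] costs [eps] in the average
    and [eps] in CVaR; [avg_tail_ge] does the rest. *)
Lemma avg_quantile_ge : a * (CVaR P a (hu \o xi) - CVaR P a (h0 \o xi)) -
  (2 * eps + M * (6 * delta + 2 * rho)) <=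
  avg (fun k => q k * (hu (z k) - h0 (z k))).
Proof.
have [p [pqr pa]] := common_cap; have /andP[qa _] := avg_quantile_weight.
have ra : a - delta <= avg r.
  by have := good (inr None); rewrite PT /= ler_norml => /andP[+ _]; rewrite /r; lra.
have CV : CVaR P a (hu \o xi) <= CVaR P a (h \o xi) + eps.
  have := @CVaR_le_combination _ _ _ P L a 0 eps (hu \o xi) (h \o xi) (h \o xi).
  rewrite subr0 mul1r mul0r addr0; apply => //; first by rewrite lexx ler01.
  move=> w /=; rewrite mul1r mul0r addr0.
  by have := le_huh (xi_Xi w); rewrite ler_norml => /andP[_]; lra.
have step : avg (fun k => r k * (h (z k) - h0 (z k)) - eps -
    M * (p k - q k + (p k - r k))) <=
    avg (fun k => q k * (hu (z k) - h0 (z k))).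
  apply: avg_le => k kt; have Xk := z_Xi kt; have [pq pr] := pqr k kt.
  have r01 : r k = 0 \/ r k = 1 by rewrite /r indicE; case: (_ \in _); [right|left].
  have q01 : q k = 0 \/ q k = 1 by rewrite /q; case: leP; [right|left].
  have := le_huh Xk; have := le_huh0 Xk.
  rewrite !ler_norml => /andP[? ?] /andP[? ?].
  by case: r01 => r01; case: q01 => q01; rewrite r01 q01 in pq pr *; nra.
apply: le_trans step.
rewrite avgB avgB avg_cst avgZ avgD !avgB.
have := avg_tail_ge; rewrite -/(r _) => tail.
have : M * (avg p - avg q + (avg p - avg r)) <= M * (2 * rho + delta).
  by rewrite ler_pM2l//; lra.
have : a * (CVaR P a (hu \o xi) - CVaR P a (h0 \o xi)) <=
    a * (CVaR P a (h \o xi) - CVaR P a (h0 \o xi)) + eps.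
  have /andP[_ a1] := a01; have := ler_wpM2l (ltW a_gt0) CV.
  have : a * eps <= eps by rewrite ler_piMl.
  lra.
by move: tail; rewrite /r; lra.
Qed.

End one_agent.

(** * Finite nets *)

Section net.
Context {R : realType} {d : nat}.

Lemma norm2_coord (u : 'rV[R]_d) j : `|u 0 j| <= norm2 u.
Proof.
rewrite -(ler_pXn2r (n := 2)) ?nnegrE ?norm2_ge0// real_normK ?num_real//.
rewrite sqr_norm2 /dotp big_ord1 (bigD1 j)//= -expr2 lerDl.
by apply: sumr_ge0 => k _; rewrite -expr2 sqr_ge0.
Qed.

Lemma norm2_le_sum (u : 'rV[R]_d) (e : R) : 0 <= e ->
  (forall j, `|u 0 j| <= e) -> norm2 u <= d%:R * e.
Proof.
move=> e0 ue; rewrite -(ler_pXn2r (n := 2)) ?nnegrE ?norm2_ge0 ?mulr_ge0//.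
rewrite sqr_norm2 /dotp big_ord1 (@le_trans _ _ (\sum_(j < d) e ^+ 2))//.
  apply: ler_sum => j _; rewrite -expr2 -real_normK ?num_real//.
  by rewrite lerXn2r ?nnegrE.
rewrite sumr_const card_ord -[leLHS]mulr_natl exprMn ler_wpM2r ?sqr_ge0//.
by rewrite -natrX ler_nat; case: d => // k; rewrite leq_pmulr.
Qed.

(** Coordinates relative to [a0] are rescaled to $[0,n]$ and truncated; the value [n] can occur,
    whence [n + 1] cells per axis. Each cell is represented by a point of [A] in it (by [a0] if
    there is none), because the assumptions on the costs hold only on the action sets. *)
Lemma finite_net (A : set 'rV[R]_d) (a0 : 'rV[R]_d) (D : R) (n : nat) :
  0 < D -> (0 < n)%N -> A a0 ->
  (forall u v, A u -> A v -> norm2 (u - v) <= D) ->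
  exists rep : {ffun 'I_d -> 'I_n.+1} -> 'rV[R]_d,
    (forall c, A (rep c)) /\
    forall u, A u -> exists c, norm2 (u - rep c) <= d%:R * (2 * D / n%:R).
Proof.
move=> D0 n0 Aa0 diamA.
have nR : 0 < n%:R :> R by rewrite ltr0n.
have D2 : 0 < 2 * D by rewrite mulr_gt0.
pose pos (u : 'rV[R]_d) j := (u 0 j - a0 0 j + D) * n%:R / (2 * D).
pose cell u := [ffun j => inord (Num.truncn (pos u j))] : {ffun 'I_d -> 'I_n.+1}.
have posP u j : A u -> 0 <= pos u j <= n%:R.
  move=> Au; have := le_trans (norm2_coord (u - a0) j) (diamA _ _ Au Aa0).
  rewrite !mxE ler_norml => /andP[h1 h2]; apply/andP; split.
    apply: divr_ge0; last exact: ltW.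
    by apply: mulr_ge0; [lra|exact: ltW].
  by rewrite /pos ler_pdivrMr// mulrC ler_pM2l//; lra.
exists (fun c => xget a0 [set v | A v /\ cell v = c]); split => [c|u Au].
  by case: xgetP => [v _ []|].
exists (cell u); case: xgetP => [v _ [Av cv]|/(_ u)]; last by case.
apply: norm2_le_sum => [|j]; first by rewrite divr_ge0// ltW.
have /andP[u0 un] := posP u j Au; have /andP[v0 vn] := posP v j Av.
have truncE w : A w -> ((cell w) j : nat) = Num.truncn (pos w j).
  move=> Aw; rewrite ffunE inordK// ltnS.
  have /andP[w0 wn] := posP w j Aw.
  by rewrite -(ler_nat R) (le_trans _ wn)// truncn_le.
have uv : Num.truncn (pos v j) = Num.truncn (pos u j).
  by rewrite -!truncE// cv.
have := truncn_itv u0; have := truncn_itv v0; rewrite uv => /andP[a1 a2] /andP[a3 a4].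
rewrite !mxE.
have -> : u 0 j - v 0 j = (pos u j - pos v j) * (2 * D / n%:R).
  by rewrite /pos; field; rewrite !gt_eqF.
have e0 : 0 <= 2 * D / n%:R by rewrite divr_ge0// ltW.
rewrite normrM (ger0_norm e0) ler_piMl// ler_norml.
by rewrite -natr1 in a2 a4; lra.
Qed.

End net.

(** * First-order inequalities of the game *)

Section game.
Context {R : realType} {N d nxi : nat} (D B m L0 p : R).
Context {disp : measure_display} {Omega : measurableType disp}.
Variables (P : probability Omega R) (X : 'I_N -> set 'rV[R]_d).
Variables (Xi : 'I_N -> set (nxi.-tuple R)) (xi : 'I_N -> {RV P >-> nxi.-tuple R}).
Variables (J : 'I_N -> 'M[R]_(N, d) -> nxi.-tuple R -> R).
Variables (f : 'I_N -> 'rV[R]_d -> nxi.-tuple R -> R).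
Variables (g : 'I_N -> 'M[R]_(N, d) -> R) (alpha : 'I_N -> R).
Variable xstar : 'M[R]_(N, d).
Hypothesis alpha01 : forall i, 0 < alpha i <= 1.
Hypothesis setting : game_setting D X Xi xi J.
Hypothesis decomposition : decomposable_monotone m X Xi xi J alpha f g.
Hypothesis gradients : bounded_gradients B X Xi J.
Hypothesis regular : regular_distributions L0 p X Xi xi J.
Hypothesis nash_xstar :
  nash X (fun i y => CVaR P (alpha i) (fun w => J i y (xi i w))) xstar.
Implicit Types (i : 'I_N) (x : 'M[R]_(N, d)) (u v : 'rV[R]_d).

Let convex_X i : convex_set (X i). Proof. by case: setting => + _; apply. Qed.

Let diam_X i u v : X i u -> X i v -> norm2 (u - v) <= D.
Proof. by case: setting => _ [+ _]; apply. Qed.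

Let xi_Xi i w : Xi i (xi i w).
Proof. by case: setting => _ [_ [_ [+ _]]]; apply. Qed.

Let joint_xstar : joint X xstar. Proof. by case: nash_xstar. Qed.

Let X_xstar i : X i (row i xstar). Proof. exact: joint_xstar. Qed.

(** A stand-in for [f i u z], from which it differs by the deterministic [anchored_g i u]:
    integrability and the Lipschitz distribution function are assumed for [J], not for [f]. *)
Definition anchored i u z := J i (deviate i u xstar) z.
Definition anchored_g i u := g i (deviate i u xstar).
Local Notation H := anchored.
Local Notation G := anchored_g.

Let joint_anchor i u : X i u -> joint X (deviate i u xstar).
Proof. by move=> Xu; exact: joint_deviate. Qed.

Lemma measurable_anchored i u : X i u -> measurable_fun (Xi i) (H i u).
Proof.
by move=> /joint_anchor; case: setting => _ [_ [_ [_ [+ _]]]]; apply.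
Qed.

Lemma integrable_anchored i u : X i u ->
  P.-integrable setT (EFin \o (H i u \o xi i)).
Proof.
by move=> /joint_anchor; case: setting => _ [_ [_ [_ [_ [+ _]]]]]; apply.
Qed.

Lemma lipschitz_anchored i u : X i u ->
  `|L0|.-lipschitz (distr_fun P (H i u \o xi i)).
Proof.
move=> /joint_anchor/(@regular i)[h _] [a b] ab /=.
by apply: le_trans (h (a, b) ab) _; rewrite ler_wpM2r// ler_norm.
Qed.

Lemma cost_decomposition i x z : joint X x -> Xi i z ->
  J i x z = H i (row i x) z + (g i x - G i (row i x)).
Proof.
move=> Xx Xz; case: decomposition => Jfg _.
rewrite /H /G !Jfg//; last exact: joint_anchor (Xx i).
by rewrite row_deviate; ring.
Qed.

(** On the action set [H i u z - G i u] is [f i u z], which is convex in [u]. *)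
Lemma anchored_segment i u v z (s : R) : X i u -> X i v -> Xi i z ->
  0 <= s <= 1 ->
  H i (u + s *: (v - u)) z - G i (u + s *: (v - u)) <=
  H i u z - G i u + s * ((H i v z - G i v) - (H i u z - G i u)).
Proof.
move=> Xu Xv Xz s01; have Xs := convex_set_segment (@convex_X i) Xu Xv s01.
case: decomposition => Jfg [_ [_ [fconv _]]].
have HG w : X i w -> H i w z - G i w = f i w z.
  by move=> Xw; rewrite /H /G Jfg ?row_deviate ?addrK//; exact: joint_anchor.
by rewrite !HG//; exact: convex_function_segment (fconv _ _ Xz) _ _ _.
Qed.

Lemma cost_gradient_ge i x v z : joint X x -> X i v -> Xi i z ->
  J i x z - J i (deviate i v x) z <= dotp (pgrad i (J i ^~ z) x) (row i x - v).
Proof.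
move=> Xx Xv Xz; rewrite -(opprB v) dotpNr -[leLHS]opprB lerN2.
have dJ : differentiable (J i ^~ z) x.
  by case: setting => _ [_ [_ [_ [_ [_ [_ [_ +]]]]]]]; apply.
have slope := slope_deviate (i := i) (w := v - row i x) dJ.
apply: (slope_le slope) => s /andP[s0 s1].
rewrite ler_pdivrMl//.
have Jconv : convex_function (X i) (fun u => J i (deviate i u x) z).
  by case: setting => _ [_ [_ [_ [_ [_ [+ _]]]]]]; apply.
have := convex_function_segment Jconv (Xx i) Xv (s := s).
by rewrite (ltW s0) (ltW s1) deviate_row => /(_ isT); lra.
Qed.

Lemma cost_gradient_le i x v z : joint X x -> X i v -> Xi i z ->
  `|dotp (pgrad i (J i ^~ z) x) (row i x - v)| <= B * norm2 (row i x - v).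
Proof.
move=> Xx Xv Xz; have Bx := gradients Xx Xz (i := i).
rewrite ler_norml -[in X in X && _](norm2N (row i x - v)) -lerNl -dotpNr.
by rewrite !(le_trans (dotp_le_norm2 _ _))// ler_wpM2r ?norm2_ge0.
Qed.

(** For a convex cost, the subgradient inequality at either end point, with the gradient bound
    there, replaces a mean value argument. *)
Lemma anchored_lipschitz i u v z : X i u -> X i v -> Xi i z ->
  `|H i u z - H i v z| <= B * norm2 (u - v).
Proof.
have le u' v' : X i u' -> X i v' -> Xi i z ->
    H i u' z - H i v' z <= B * norm2 (u' - v').
  move=> Xu Xv Xz; have Ju := joint_anchor Xu.
  have := cost_gradient_ge Ju Xv Xz; have := cost_gradient_le Ju Xv Xz.
  rewrite row_deviate deviate_deviate => /(le_trans (ler_norm _)) h1 h2.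
  exact: le_trans h2 h1.
move=> Xu Xv Xz; rewrite ler_norml; apply/andP; split; last exact: le.
by rewrite lerNl opprB -norm2N opprB; exact: le.
Qed.

(** Subgradient inequality for the [f] part alone: slopes of [J - g] along the segment to [v] are
    slopes of the convex [f]. The gradient of [g] stays exact, ready for strong monotonicity. *)
Lemma cost_gradient_split i x v z : joint X x -> X i v -> Xi i z ->
  dotp (pgrad i (g i) x) (row i x - v) - (G i (row i x) - G i v) +
    (H i (row i x) z - H i v z) <=
  dotp (pgrad i (J i ^~ z) x) (row i x - v).
Proof.
move=> Xx Xv Xz.
have dJ : differentiable (J i ^~ z) x.
  by case: setting => _ [_ [_ [_ [_ [_ [_ [_ +]]]]]]]; apply.
have dg : differentiable (fun u => g i (deviate i u x)) (row i x).
  by case: decomposition => _ [_ [_ [_ [+ _]]]]; apply.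
have slope : s^-1 * (J i (deviate i (row i x + s *: (v - row i x)) x) z - J i x z) -
    s^-1 * (g i (deviate i (row i x + s *: (v - row i x)) x) - g i x) @[s --> 0^'] -->
    dotp (pgrad i (J i ^~ z) x) (v - row i x) -
    dotp (pgrad i (g i) x) (v - row i x).
  by apply: cvgB; [exact: slope_deviate|exact: slope_deviate_row].
have : dotp (pgrad i (J i ^~ z) x) (v - row i x) -
    dotp (pgrad i (g i) x) (v - row i x) <=
    (H i v z - G i v) - (H i (row i x) z - G i (row i x)).
  apply: (slope_le slope) => s /andP[s0 s1].
  have s01 : 0 <= s <= 1 by rewrite (ltW s0) (ltW s1).
  have Xs := convex_set_segment (@convex_X i) (Xx i) Xv s01.
  have := anchored_segment (Xx i) Xv Xz s01.
  rewrite /= -mulrBr ler_pdivrMl//.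
  rewrite (cost_decomposition (joint_deviate Xs Xx) Xz) row_deviate.
  rewrite (cost_decomposition Xx Xz); lra.
rewrite -(opprB v) !dotpNr; lra.
Qed.

Local Notation C i u := (CVaR P (alpha i) (H i u \o xi i)).

(** [C i u - G i u] is the CVaR of [f i u]. A step [s] from equilibrium towards [u] does not lower
    the cost; convexity bounds the CVaR part by its chord, so after division by [s] only [g] needs a
    limit. *)
Lemma nash_variational i u : X i u ->
  0 <= C i u - C i (row i xstar) - (G i u - G i (row i xstar)) +
    dotp (pgrad i (g i) xstar) (u - row i xstar).
Proof.
move=> Xu; set v := row i xstar; have Xv : X i v := @X_xstar i.
have dg : differentiable (fun u => g i (deviate i u xstar)) (row i xstar).
  by case: decomposition => _ [_ [_ [_ [+ _]]]]; apply.
have slope : - (s^-1 * (g i (deviate i (v + s *: (u - v)) xstar) - g i xstar))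
    @[s --> 0^'] --> - dotp (pgrad i (g i) xstar) (u - v).
  by apply: cvgN; exact: slope_deviate_row.
suff : - dotp (pgrad i (g i) xstar) (u - v) <= C i u - C i v - (G i u - G i v).
  by lra.
apply: (slope_le slope) => s /andP[s0 s1] /=.
have s01 : 0 <= s <= 1 by rewrite (ltW s0) (ltW s1).
have Xs := convex_set_segment (@convex_X i) Xv Xu s01.
have Cv : C i v <= C i (v + s *: (u - v)).
  case: nash_xstar => _ /(_ i _ Xs); apply: le_trans.
  by rewrite /H /comp /v deviate_row.
have := CVaR_le_combination (c := G i (v + s *: (u - v)) - (1 - s) * G i v - s * G i u)
  (integrable_anchored Xs) (integrable_anchored Xv) (integrable_anchored Xu)
  (lipschitz_anchored Xs) (lipschitz_anchored Xv) (lipschitz_anchored Xu)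
  (alpha01 i) s01.
have le_H w : (H i (v + s *: (u - v)) \o xi i) w <=
    (1 - s) * (H i v \o xi i) w + s * (H i u \o xi i) w +
    (G i (v + s *: (u - v)) - (1 - s) * G i v - s * G i u).
  by have := anchored_segment Xv Xu (xi_Xi i w) s01; rewrite /=; lra.
move=> /(_ le_H) Cs; rewrite -mulrN ler_pdivrMl// -/v.
have -> : g i (deviate i (v + s *: (u - v)) xstar) = G i (v + s *: (u - v)) by [].
have -> : g i xstar = G i v by rewrite /G /v deviate_row.
move: (C i _) (C i v) (C i u) Cv Cs => a b c h1 h2; lra.
Qed.

(** * The gradient estimate of one agent in one episode *)

Section estimate.
Variables (i : 'I_N) (x : 'M[R]_(N, d)) (t : nat) (z : nat -> nxi.-tuple R).
Hypothesis joint_x : joint X x.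
Hypothesis t_gt0 : (0 < t)%N.
Hypothesis B_gt0 : 0 < B.
Hypothesis z_Xi : forall k, (1 <= k < t.+1)%N -> Xi i (z k).

Definition gradient_estimate : 'rV[R]_d :=
  cvar_grad_est (alpha i) t (fun k => J i x (z k))
    (fun k => pgrad i (J i ^~ (z k)) x).

Let a := alpha i.
Let weight k : R :=
  (VaR a (emp_cdf t (fun k => J i x (z k))) <= (J i x (z k))%:E)%E%:R.

Let a_gt0 : 0 < a. Proof. by case/andP: (alpha01 i). Qed.

Let tR_gt0 : 0 < t%:R :> R. Proof. by rewrite ltr0n. Qed.

Let dotp_estimate v : dotp gradient_estimate v =
  a^-1 * (t%:R^-1 *
    \sum_(1 <= k < t.+1) weight k * dotp (pgrad i (J i ^~ (z k)) x) v).
Proof.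
rewrite /gradient_estimate /cvar_grad_est dotpZl dotp_suml invfM mulrA.
rewrite [a^-1 * _]mulrC; congr (_ * _).
by apply: eq_bigr => k _; rewrite dotpZl.
Qed.

(** Pairing the estimate with itself reduces the claim to Cauchy-Schwarz for each sample, all
    weights being at most 1. *)
Lemma norm2_gradient_estimate : norm2 gradient_estimate <= B / a.
Proof.
have [->|e0] := eqVneq (norm2 gradient_estimate) 0.
  by rewrite divr_ge0// ltW.
have eg0 : 0 < norm2 gradient_estimate by rewrite lt_def e0 norm2_ge0.
rewrite -(ler_pM2r eg0) -expr2 sqr_norm2 dotp_estimate.
set e := gradient_estimate.
rewrite mulrAC -[leRHS]mulrC ler_pM2l ?invr_gt0// ler_pdivrMl//.
apply: (@le_trans _ _ (\sum_(1 <= k < t.+1) B * norm2 e)); last first.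
  by rewrite sumr_const_nat subn1/= mulr_natl.
rewrite big_nat [leRHS]big_nat ler_sum// => k /z_Xi zk.
have Bk := gradients joint_x zk.
have le_e : dotp (pgrad i (J i ^~ (z k)) x) e <= B * norm2 e.
  by rewrite (le_trans (dotp_le_norm2 _ _))// ler_wpM2r ?norm2_ge0.
rewrite /weight; case: (_ <= _)%E; rewrite ?mul1r// mul0r.
by rewrite mulr_ge0 ?norm2_ge0// ltW.
Qed.

Variables (T : nat) (delta : R) (u : 'rV[R]_d).
Hypothesis D_gt0 : 0 < D.
Hypothesis T_gt0 : (0 < T)%N.
Hypothesis delta_gt0 : 0 < delta.
Hypothesis T_delta : T%:R^-1 <= delta.
Hypothesis Xu : X i u.
Let eps := B * (d%:R * (2 * D / T%:R)).
Hypothesis u_near : norm2 (row i x - u) <= d%:R * (2 * D / T%:R).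
Local Notation test := (@test_event _ _ _ _ P _ (xi i) (Xi i) a (B * D) eps delta T
  (H i u) (H i (row i xstar))).
Hypothesis good : forall ty,
  `|t%:R^-1 * \sum_(1 <= k < t.+1) \1_(test ty) (z k) -
    fine (P (xi i @^-1` test ty))| <= delta.

Let M := B * D.
Let rho := 3 * delta + 2 * eps * `|L0|.
Let y := row i x - row i xstar.

(** [cost_gradient_split] for each selected sample leaves a weighted average of anchored cost
    differences. [avg_quantile_ge] compares it with a CVaR difference, which [nash_variational]
    trades for the gradient of [g] at equilibrium. *)
Lemma gradient_estimate_progress :
  dotp (pgrad i (g i) x - pgrad i (g i) xstar) y -
    a^-1 * (2 * eps + M * (6 * delta + 4 * rho)) <= dotp gradient_estimate y.
Proof.
have M_gt0 : 0 < M by rewrite mulr_gt0.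
have Xx : X i (row i x) by exact: joint_x.
have Xs := @X_xstar i.
have mXi : measurable (Xi i) by case: setting => _ [_ [+ _]]; apply.
have le_M v v' s : X i v -> X i v' -> Xi i s -> `|H i v s - H i v' s| <= M.
  move=> Xv Xv' Xs'; apply: le_trans (anchored_lipschitz Xv Xv' Xs') _.
  by rewrite ler_pM2l//; exact: diam_X Xv Xv'.
have eps0 : 0 <= eps.
  by rewrite !mulr_ge0 ?invr_ge0// ltW.
have le_eps s : Xi i s -> `|H i (row i x) s - H i u s| <= eps.
  move=> Xs'; apply: le_trans (anchored_lipschitz Xx Xu Xs') _.
  by rewrite ler_pM2l.
pose b := g i x - G i (row i x).
have JE : emp_cdf t (fun k => J i x (z k)) =
    emp_cdf t (fun k => H i (row i x) (z k) + b).
  apply/funext => c; congr (_ * _); apply: eq_big_nat => k kt.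
  by rewrite (cost_decomposition joint_x (z_Xi kt)).
have weightE k : (1 <= k < t.+1)%N -> weight k =
    (VaR a (emp_cdf t (fun k => H i (row i x) (z k) + b)%R) <=
      (H i (row i x) (z k) + b)%R%:E)%E%:R.
  by move=> kt; rewrite /weight JE (cost_decomposition joint_x (z_Xi kt)).
have mxi : measurable_fun setT (xi i) by exact: measurable_funPT.
have := avg_quantile_weight (@xi_Xi i) (integrable_anchored Xu)
  (lipschitz_anchored Xu) (alpha01 i) delta_gt0 t_gt0 z_Xi good b eps0 le_eps.
have := avg_quantile_ge mXi (measurable_anchored Xu) (measurable_anchored Xs)
  (@xi_Xi i) mxi (integrable_anchored Xu) (integrable_anchored Xs)
  (lipschitz_anchored Xu) (lipschitz_anchored Xs) (alpha01 i) M_gt0 delta_gt0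
  T_gt0 T_delta (fun s => @le_M _ _ s Xu Xs) t_gt0 z_Xi good b
  (integrable_anchored Xx) (lipschitz_anchored Xx) eps0 le_eps
  (fun s => @le_M _ _ s Xx Xs).
rewrite /= -/rho -/M.
have sumE (v : nat -> R) : \sum_(1 <= k < t.+1)
    (VaR (alpha i) (emp_cdf t (fun k => H i (row i x) (z k) + b)%R) <=
      (H i (row i x) (z k) + b)%R%:E)%E%:R * v k =
    \sum_(1 <= k < t.+1) weight k * v k.
  by apply: eq_big_nat => k kt; rewrite weightE.
have sumE1 : \sum_(1 <= k < t.+1)
    (VaR (alpha i) (emp_cdf t (fun k => H i (row i x) (z k) + b)%R) <=
      (H i (row i x) (z k) + b)%R%:E)%E%:R = \sum_(1 <= k < t.+1) weight k.
  by apply: eq_big_nat => k kt; rewrite weightE.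
rewrite sumE sumE1 -/a.
set Y := t%:R^-1 * _; set A := t%:R^-1 * _.
move=> Y_ge /andP[A_ge A_le].
pose a' := dotp (pgrad i (g i) x) y - (G i (row i x) - G i (row i xstar)).
pose W := t%:R^-1 *
  \sum_(1 <= k < t.+1) weight k * dotp (pgrad i (J i ^~ (z k)) x) y.
have w0 k : 0 <= weight k by [].
have avg_le (v v' : nat -> R) : (forall k, (1 <= k < t.+1)%N -> v k <= v' k) ->
    t%:R^-1 * \sum_(1 <= k < t.+1) v k <= t%:R^-1 * \sum_(1 <= k < t.+1) v' k.
  move=> vv'; rewrite ler_wpM2l ?invr_ge0// big_nat [leRHS]big_nat.
  exact: ler_sum.
have W_ge : A * a' + Y <= W.
  rewrite /A /Y /W -mulrA -mulrDr mulr_suml -big_split; apply: avg_le => k kt /=.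
  rewrite -mulrDr ler_wpM2l//.
  exact: (cost_gradient_split joint_x Xs (z_Xi kt)).
have W_le : - (A * M) <= W.
  rewrite /A /W -mulrA -mulrN mulr_suml -sumrN; apply: avg_le => k kt.
  rewrite -mulrN ler_wpM2l//.
  have := cost_gradient_le joint_x Xs (z_Xi kt); rewrite ler_norml => /andP[+ _].
  by apply: le_trans; rewrite lerN2 ler_pM2l//; exact: diam_X Xx Xs.
have Y_le : Y <= A * M.
  rewrite /A /Y -mulrA mulr_suml; apply: avg_le => k kt.
  rewrite ler_wpM2l// (le_trans (ler_norm _))//.
  exact: le_M (z_Xi kt).
have A0 : 0 < A by exact: lt_le_trans A_ge.
(* The total weight [A] is only known to lie in $[a,a+\rho]$, and replacing [A * a'] by [a * a']
   directly would need a bound on [a']. Splitting $AW=aW+(A-a)W$ avoids this: [W_ge] is applied to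
   the first term, the crude bound [W_le] to the second. *)
have W_key : a * a' + Y - 2 * M * rho <= W.
  rewrite -(ler_pM2l A0).
  have Aa : 0 <= A - a by rewrite subr_ge0.
  have h1 : 0 <= (A - a) * (A * M - Y) by rewrite mulr_ge0// subr_ge0.
  have h2 := ler_wpM2l (ltW a_gt0) W_ge.
  have h3 := ler_wpM2l Aa W_le.
  have h4 : 0 <= A * M * (rho - (A - a)).
    apply: mulr_ge0; first exact: mulr_ge0 (ltW A0) (ltW M_gt0).
    by rewrite subr_ge0 lerBlDl.
  rewrite (_ : A * W = a * W + (A - a) * W); last by ring.
  lra.
have := nash_variational Xx; rewrite -/y => nv.
rewrite dotp_estimate -/W.
rewrite [leRHS]mulrC ler_pdivlMr// mulrBl mulrAC mulVf ?gt_eqF// mul1r.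
have := ler_wpM2l (ltW a_gt0) nv.
rewrite mulr0 dotpBl; move: Y_ge W_key; rewrite /a'.
move: (CVaR P a _ ) (CVaR P a _) => c c' *; lra.
Qed.

End estimate.

End game.

(** * Regret of the learning algorithm *)

Section regret.
Context {R : realType} {N d nxi : nat} (D B m L0 p : R).
Context {disp : measure_display} {Omega : measurableType disp}.
Variables (P : probability Omega R) (X : 'I_N -> set 'rV[R]_d).
Variables (Xi : 'I_N -> set (nxi.-tuple R)) (xi : 'I_N -> {RV P >-> nxi.-tuple R}).
Variables (J : 'I_N -> 'M[R]_(N, d) -> nxi.-tuple R -> R).
Variables (f : 'I_N -> 'rV[R]_d -> nxi.-tuple R -> R).
Variables (g : 'I_N -> 'M[R]_(N, d) -> R) (alpha : 'I_N -> R).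
Variable xstar : 'M[R]_(N, d).
Hypothesis alpha01 : forall i, 0 < alpha i <= 1.
Hypothesis setting : game_setting D X Xi xi J.
Hypothesis decomposition : decomposable_monotone m X Xi xi J alpha f g.
Hypothesis gradients : bounded_gradients B X Xi J.
Hypothesis regular : regular_distributions L0 p X Xi xi J.
Hypothesis nash_xstar :
  nash X (fun i y => CVaR P (alpha i) (fun w => J i y (xi i w))) xstar.
Hypothesis B_gt0 : 0 < B.
Hypothesis m_gt0 : 0 < m.

Lemma dist_joint_le x : joint X x -> norm2 (x - xstar) ^+ 2 <= N%:R * D ^+ 2.
Proof.
move=> Xx; rewrite sqr_norm2 dotp_row.
apply: (@le_trans _ _ (\sum_(i < N) D ^+ 2)); last first.
  by rewrite sumr_const card_ord mulr_natl.
apply: ler_sum => i _; rewrite -sqr_norm2 raddfB/=.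
case: setting => _ [diam _]; case: nash_xstar => Xs _.
have h := diam i _ _ (Xx i) (Xs i).
by rewrite lerXn2r ?nnegrE ?norm2_ge0// (le_trans _ h)// norm2_ge0.
Qed.

Hypothesis D_gt0 : 0 < D.
Variable T : nat.
Hypothesis T_gt0 : (0 < T)%N.
Variables (z : 'I_N -> nat -> nxi.-tuple R) (x : nat -> 'M[R]_(N, d)) (eta : R).
Hypothesis eta_gt0 : 0 < eta.
Hypothesis z_Xi : forall i k, (1 <= k < T.+1)%N -> Xi i (z i k).
Hypothesis joint_x1 : joint X (x 1%N).
Hypothesis x_step : forall t i, (1 <= t < T)%N ->
  is_projection (X i) (row i (x t) - eta *:
    cvar_grad_est (alpha i) t (fun k => J i (x t) (z i k))
      (fun k => pgrad i (J i ^~ (z i k)) (x t))) (row i (x t.+1)).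
Variables (delta : nat -> R) (rep : 'I_N -> {ffun 'I_d -> 'I_T.+1} -> 'rV[R]_d).
Hypothesis delta_gt0 : forall t, (1 <= t < T.+1)%N -> 0 < delta t.
Hypothesis T_delta : forall t, (1 <= t < T.+1)%N -> T%:R^-1 <= delta t.
Hypothesis X_rep : forall i c, X i (rep i c).
Hypothesis rep_near : forall i u, X i u ->
  exists c, norm2 (u - rep i c) <= d%:R * (2 * D / T%:R).
Let eps := B * (d%:R * (2 * D / T%:R)).
Hypothesis good : forall i t c (ty : ('I_T + option bool)%type), (1 <= t < T.+1)%N ->
  let A := test_event P (xi i) (Xi i) (alpha i) (B * D) eps (delta t)
    (anchored J xstar i (rep i c)) (anchored J xstar i (row i xstar)) ty in
  `|t%:R^-1 * \sum_(1 <= k < t.+1) \1_A (z i k) - fine (P (xi i @^-1` A))|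
    <= delta t.

Let err t := 2 * eps +
  B * D * (6 * delta t + 4 * (3 * delta t + 2 * eps * `|L0|)).
Let S1 := \sum_i (alpha i)^-1.
Let S2 := \sum_i (alpha i) ^- 2.
Let Y t := norm2 (x t - xstar) ^+ 2.

Lemma joint_run t : (1 <= t < T.+1)%N -> joint X (x t).
Proof.
elim: t => // -[|t] IH // /andP[_ tT] i.
by have [//] := @x_step t.+1 i tT.
Qed.

(** Expand the square of each agent's projected step and sum over the agents: only the sum of the
    inner products is controlled by strong monotonicity. *)
Lemma distance_step t : (1 <= t < T)%N ->
  Y t.+1 + 2 * eta * m * Y t <=
  Y t + (2 * eta * (S1 * err t) + eta ^+ 2 * (B ^+ 2 * S2)).
Proof.
move=> tT; have tT' : (1 <= t < T.+1)%N.
  by case/andP: tT => -> /ltnW/=; rewrite ltnS.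
have Xx := joint_run tT'; have [Xs _] := nash_xstar.
pose est i := gradient_estimate J alpha i (x t) t (z i).
have zt i k : (1 <= k < t.+1)%N -> Xi i (z i k).
  case/andP=> k1 kt; apply: z_Xi; rewrite k1/=.
  by case/andP: tT' => _; exact: leq_ltn_trans.
have t0 : (0 < t)%N by case/andP: tT.
have row_le i : norm2 (row i (x t.+1) - row i xstar) ^+ 2 <=
    norm2 (row i (x t) - row i xstar) ^+ 2 -
    2 * eta * (dotp (pgrad i (g i) (x t) - pgrad i (g i) xstar)
       (row i (x t) - row i xstar) - (alpha i)^-1 * err t) +
    eta ^+ 2 * (B ^+ 2 * alpha i ^- 2).
  have cX : convex_set (X i) by case: setting => + _; apply.
  apply: (le_trans (projection_nonexpansive cX (@x_step t i tT) (Xs i))).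
  rewrite -/(gradient_estimate J alpha i (x t) t (z i)) -/(est i).
  have [c near_c] := rep_near (Xx i).
  have progress := gradient_estimate_progress alpha01 setting decomposition
    gradients regular nash_xstar Xx t0 B_gt0 (zt i) D_gt0 T_gt0 (delta_gt0 tT')
    (T_delta tT') (X_rep i c) near_c (fun ty => good i c ty tT').
  have size := norm2_gradient_estimate alpha01 gradients Xx t0 B_gt0 (zt i).
  rewrite -/(est i) in progress size.
  have sq : dotp (est i) (est i) <= B ^+ 2 * alpha i ^- 2.
    rewrite -sqr_norm2 -exprVn -exprMn lerXn2r ?nnegrE ?norm2_ge0//.
    by rewrite divr_ge0 ?ltW//; case/andP: (alpha01 i).
  rewrite !sqr_norm2 addrAC.
  move: (row i (x t) - row i xstar) (est i) progress sq => y e progress sq.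
  move: progress; rewrite -/eps -/(err t).
  move: (dotp (pgrad i (g i) (x t) - _) y) => v progress.
  rewrite dotpBl !dotpBr !dotpZl !dotpZr (dotpC y e).
  have h1 := ler_wpM2l (ltW (mulr_gt0 (ltr0n R 2) eta_gt0)) progress.
  have h2 := ler_wpM2l (sqr_ge0 eta) sq.
  lra.
have YE k : Y k = \sum_i norm2 (row i (x k) - row i xstar) ^+ 2.
  rewrite /Y sqr_norm2 dotp_row; apply: eq_bigr => i _.
  by rewrite -sqr_norm2 raddfB.
have mono : m * Y t <= \sum_i dotp (pgrad i (g i) (x t) - pgrad i (g i) xstar)
    (row i (x t) - row i xstar).
  by case: decomposition => _ [_ [_ [_ [_ +]]]]; apply.
have := ler_sum (index_enum 'I_N) (P := xpredT) (fun i _ => row_le i).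
rewrite -YE big_split/= sumrB -YE -2!mulr_sumr sumrB -mulr_suml -/S1 -!mulr_sumr -/S2.
have := ler_wpM2l (ltW (mulr_gt0 (ltr0n R 2) eta_gt0)) mono.
lra.
Qed.

(* There is no update after episode T, whence the separate diameter bound
   [N%:R * D ^+ 2] on the last distance. *)
Lemma regret_bound : \sum_(1 <= t < T.+1) Y t <= N%:R * D ^+ 2 +
  m^-1 * (N%:R * D ^+ 2 / (2 * eta) + S1 * \sum_(1 <= t < T.+1) err t +
          eta / 2 * T%:R * B ^+ 2 * S2).
Proof.
have S2_ge0 : 0 <= S2.
  by apply: sumr_ge0 => i _; rewrite invr_ge0 sqr_ge0.
have S1_ge0 : 0 <= S1.
  by apply: sumr_ge0 => i _; rewrite invr_ge0 ltW//; case/andP: (alpha01 i).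
have err_ge0 t : (1 <= t < T.+1)%N -> 0 <= err t.
  move=> /delta_gt0/ltW dt; have e0 : 0 <= eps.
    by rewrite !mulr_ge0 ?invr_ge0// ltW.
  by rewrite /err addr_ge0 ?mulr_ge0 ?addr_ge0 ?mulr_ge0 ?addr_ge0 ?mulr_ge0// ltW.
have telescope n : (n < T)%N ->
    Y n.+1 + 2 * eta * m * \sum_(1 <= t < n.+1) Y t <= Y 1%N +
    \sum_(1 <= t < n.+1) (2 * eta * (S1 * err t) + eta ^+ 2 * (B ^+ 2 * S2)).
  elim: n => [|n IH] nT; first by rewrite !big_geq// mulr0 !addr0.
  have := IH (ltnW nT); have := @distance_step n.+1 nT.
  rewrite (@big_nat_recr _ _ _ n.+1 1)//= [X in _ -> _ -> _ <= _ + X]big_nat_recr//=.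
  by rewrite mulrDr; lra.
have TE : T.-1.+1 = T by rewrite prednK.
have := telescope T.-1; rewrite TE leqnn => /(_ isT).
rewrite (@big_nat_recr _ _ _ T 1)//= [\sum_(1 <= t < T.+1) err t]big_nat_recr//=.
rewrite big_split/= -!mulr_sumr sumr_const_nat.
have YT := dist_joint_le (@joint_run T _); rewrite T_gt0 ltnS leqnn in YT.
have Y1 := dist_joint_le joint_x1.
have YT0 : 0 <= Y T by rewrite sqr_ge0.
have eT : 0 <= S1 * err T by rewrite mulr_ge0// err_ge0// T_gt0 ltnS leqnn.
have {}YT := YT isT; rewrite -/(Y T) in YT; rewrite -/(Y 1%N) in Y1.
move: (\sum_(1 <= t < T) Y t) (\sum_(1 <= t < T) err t) => s e h.
suff : s <= m^-1 * (N%:R * D ^+ 2 / (2 * eta) + S1 * (e + err T) +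
    eta / 2 * T%:R * B ^+ 2 * S2) by lra.
rewrite mulrC ler_pdivlMr//.
have e2 : 0 < 2 * eta by rewrite mulr_gt0.
rewrite -(ler_pM2l e2).
have -> : 2 * eta * (N%:R * D ^+ 2 / (2 * eta) + S1 * (e + err T) +
    eta / 2 * T%:R * B ^+ 2 * S2) = N%:R * D ^+ 2 +
    2 * eta * (S1 * e) + 2 * eta * (S1 * err T) + T%:R * (eta ^+ 2 * (B ^+ 2 * S2)).
  by field; rewrite gt_eqF.
have h1 : 0 <= 2 * eta * (S1 * err T) by rewrite mulr_ge0// ltW.
have h2 : eta ^+ 2 * (B ^+ 2 * S2) *+ (T - 1) <= T%:R * (eta ^+ 2 * (B ^+ 2 * S2)).
  rewrite -mulr_natl ler_wpM2r ?ler_nat ?leq_subr//.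
  by rewrite mulr_ge0 ?sqr_ge0// mulr_ge0 ?sqr_ge0.
lra.
Qed.

End regret.

(** With $b^2=a^2+1$, expanding $(b-a)^2\ge0$ gives $1/b\le2(b-a)$, which telescopes. This sums the
    deviations [delta t], of order $t^{-1/2}$. *)
Lemma sum_invsqrt_le {R : realType} (n : nat) :
  \sum_(1 <= t < n.+1) (Num.sqrt t%:R)^-1 <= 2 * Num.sqrt n%:R :> R.
Proof.
elim: n => [|n IH]; first by rewrite big_geq// sqrtr0 mulr0.
rewrite big_nat_recr//=; set a := Num.sqrt n%:R in IH *.
set b := Num.sqrt n.+1%:R.
have b0 : 0 < b by rewrite sqrtr_gt0 ltr0n.
have a0 : 0 <= a by exact: sqrtr_ge0.
have ab : b ^+ 2 = a ^+ 2 + 1 by rewrite !sqr_sqrtr ?ler0n// natr1.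
suff : b^-1 <= 2 * b - 2 * a by lra.
rewrite -(ler_pM2l b0) mulfV ?gt_eqF//.
have : 0 <= (b - a) ^+ 2 by exact: sqr_ge0.
lra.
Qed.

(** * Convergence rate *)

Section uniform_deviation.
Context {R : realType} {disp : measure_display} {Omega : measurableType disp}.
Variable P : probability Omega R.

Lemma union_bound (I : Type) (s : seq I) (bad : I -> set Omega) (e : R) :
  (forall a, measurable (bad a)) -> (forall a, (P (bad a) <= e%:E)%E) ->
  measurable (\big[setU/set0]_(a <- s) bad a) /\
  (P (\big[setU/set0]_(a <- s) bad a) <= ((size s)%:R * e)%:E)%E.
Proof.
move=> mbad Pbad; elim: s => [|a s [IHm IH]].
  by rewrite big_nil measure0 mul0r.
rewrite big_cons; split; first exact: measurableU.
apply: (@le_trans _ _ (P (bad a) + P (\big[setU/set0]_(j <- s) bad j))%E).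
  exact: measureU2.
by rewrite /= -natr1 mulrDl mul1r addrC EFinD leeD.
Qed.

(** The sets [A i t a] are fixed before sampling, so independence applies to each; the conclusion
    holds for all of them simultaneously and can be used at actions that depend on the samples. *)
Lemma uniform_deviation {N nxi T : nat} (I : finType)
    (Xi : 'I_N -> set (nxi.-tuple R)) (xi : 'I_N -> {RV P >-> nxi.-tuple R})
    (s : 'I_N -> nat -> {RV P >-> nxi.-tuple R})
    (A : 'I_N -> nat -> I -> set (nxi.-tuple R)) (delta : nat -> R) (e : R) :
  iid_samples Xi xi T s -> (forall i t a, measurable (A i t a)) ->
  (forall t, (1 <= t < T.+1)%N -> 0 < delta t) ->
  (forall t, (1 <= t < T.+1)%N -> 2 * expR (- (t%:R * delta t ^+ 2 / 8)) <= e) ->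
  exists G : set Omega, [/\ measurable G,
    ((1 - (N * T * #|I|)%:R * e)%:E <= P G)%E &
    forall w i t a, G w -> (1 <= t < T.+1)%N ->
      `|t%:R^-1 * \sum_(1 <= k < t.+1) \1_(A i t a) (s i k w) -
        fine (P (xi i @^-1` A i t a))| <= delta t].
Proof.
move=> iid mA delta0 small.
pose bad (b : 'I_N * 'I_T * I) := [set w | delta b.1.2.+1 <
  `|b.1.2.+1%:R^-1 * \sum_(1 <= k < b.1.2.+2) \1_(A b.1.1 b.1.2.+1 b.2) (s b.1.1 k w) -
    fine (P (xi b.1.1 @^-1` A b.1.1 b.1.2.+1 b.2))|].
have mbad b : measurable (bad b).
  by apply: measurable_freq_deviation => // k; exact: measurable_funPT.
have Pbad b : (P (bad b) <= e%:E)%E.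
  have [ind law] := iid b.1.1; have tT := ltn_ord b.1.2.
  apply: (@le_trans _ _ (2 * expR (- (b.1.2.+1%:R * delta b.1.2.+1 ^+ 2 / 8)))%:E).
    apply: (freq_deviation _ ind) => //.
    - move=> k kT; have [_ lawk] := law k kT; rewrite fineK.
        exact: (lawk _ (mA _ _ _)).
      have mxi : measurable_fun setT (xi b.1.1) by exact: measurable_funPT.
      by apply: fin_num_measure; rewrite -[X in measurable X]setTI; exact: mxi.
    - move=> k; rewrite mem_index_iota inE => /andP[-> kt].
      by rewrite -ltnS (leq_trans kt).
    - exact: delta0.
  by rewrite lee_fin small.
have [mU PU] := union_bound (index_enum _) mbad Pbad.
exists (~` (\big[setU/set0]_(b <- index_enum _) bad b)); split.
- exact: measurableC.
- rewrite probability_setC//; move: PU; set p := P _ => PU.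
  have pfin : p \is a fin_num by exact: fin_num_measure.
  rewrite -(fineK pfin) -EFinB lee_fin lerD2l lerN2 -lee_fin fineK//.
  apply: le_trans PU _; rewrite lee_fin le_eqVlt; apply/orP; left; apply/eqP.
  by rewrite -[index_enum _]enumT -cardE !card_prod !card_ord.
- move=> w i t a Gw /andP[t1 tT]; rewrite leNgt; apply/negP => dev.
  have tT' : (t.-1 < T)%N by rewrite prednK// -ltnS.
  apply: Gw; rewrite -bigcup_seq; exists ((i, Ordinal tT'), a) => /=.
    by rewrite mem_index_enum.
  by rewrite /bad/= prednK.
Qed.

End uniform_deviation.

(** Agents, episodes, net points, and [T + 3] events for each ([T] levels, the tail, two
    half-lines); the factor 2 is for two-sided deviations. A pure power of [T] is wanted so that
    $(\gamma/T)^K$ cancels it, and [N] is absorbed by $2N\le T^N$. *)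
Lemma card_events_le (N d T : nat) : (1 < T)%N ->
  (N * T * (T.+1 ^ d * (T + 3)) * 2 <= T ^ (N + 2 * d + 4))%N.
Proof.
move=> T1; have T0 : (0 < T)%N by exact: ltnW.
have N2 : (N * 2 <= T ^ N)%N.
  elim: N => // -[|N] IH; first by rewrite expn1.
  rewrite expnS; apply: leq_trans (leq_mul T1 IH); nia.
have T3 : (T + 3 <= T ^ 3)%N by rewrite !expnS expn0; nia.
have Td : (T.+1 ^ d <= T ^ (2 * d))%N.
  by rewrite expnM; case: d => // k; rewrite leq_exp2r// !expnS expn0; nia.
have -> : (T ^ (N + 2 * d + 4) = T ^ N * T * (T ^ (2 * d) * T ^ 3))%N.
  by rewrite !expnD (expnS T 3); ring.
rewrite mulnAC [(N * T * 2)%N]mulnAC.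
by rewrite leq_mul// ?leq_mul.
Qed.

Lemma ln2_ge_half {R : realType} : 2^-1 <= ln 2 :> R.
Proof.
have := @le_ln1Dx R (- 2^-1); rewrite (_ : 1 - 2^-1 = 2^-1 :> R); last by field.
by rewrite lnV ?posrE// lerN2; apply; rewrite ltrN2 invf_lt1// ltr1n.
Qed.

Section average.
Context {R : realType}.

(** Ratio of the per-episode bias to [delta t]: the net spacing contributes
    $\epsilon=\kappa/T\le\kappa\,\delta_t$. *)
Definition bias_constant (d : nat) (D B L0 : R) : R :=
  let kappa := 2 * B * D * d%:R in
  2 * kappa + 18 * (B * D) + 8 * (B * D) * `|L0| * kappa.

(** The three terms come from the last distance, from the two step-size terms of the regret, and
    from the bias, whose factor 2 is that of [sum_invsqrt_le]. *)
Definition rate_constant (N d : nat) (D B m L0 : R) : R :=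
  D ^+ 2 + D * B / m +
  2 * bias_constant d D B L0 * Num.sqrt (8 * (N + 2 * d + 4)%:R) / m.

Lemma bias_constant_ge0 d D B L0 : 0 <= D -> 0 <= B -> 0 <= bias_constant d D B L0.
Proof. by move=> D0 B0; rewrite !(addr_ge0, mulr_ge0). Qed.

Lemma rate_constant_ge0 N d D B m L0 : 0 <= D -> 0 <= B -> 0 < m ->
  0 <= rate_constant N d D B m L0.
Proof.
move=> D0 B0 m0; rewrite !addr_ge0 ?sqr_ge0 ?divr_ge0 ?mulr_ge0 ?sqrtr_ge0//.
- exact: ltW.
- exact: bias_constant_ge0.
- exact: ltW.
Qed.

Lemma average_rate (N d T : nat) (D B m L0 lam S1 S2 S : R) (delta : nat -> R) :
  0 < D -> 0 < B -> 0 < m -> (0 < T)%N -> 0 <= S1 -> N%:R <= S2 ->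
  (forall t, delta t =
    Num.sqrt (8 * (N + 2 * d + 4)%:R) * (lam * (Num.sqrt t%:R)^-1)) ->
  0 <= lam ->
  (forall t, (1 <= t < T.+1)%N -> T%:R^-1 <= delta t) ->
  let eps := B * (d%:R * (2 * D / T%:R)) in
  let eta := D / B * (Num.sqrt T%:R)^-1 in
  S <= N%:R * D ^+ 2 + m^-1 * (N%:R * D ^+ 2 / (2 * eta) +
    S1 * \sum_(1 <= t < T.+1) (2 * eps +
      B * D * (6 * delta t + 4 * (3 * delta t + 2 * eps * `|L0|))) +
    eta / 2 * T%:R * B ^+ 2 * S2) ->
  T%:R^-1 * S <= rate_constant N d D B m L0 * ((Num.sqrt T%:R)^-1 * (S2 + lam * S1)).
Proof.
move=> D0 B0 m0 T0 S10 S2N deltaE lam0 T_delta eps eta SE.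
set r := Num.sqrt T%:R in eta SE *; set c := Num.sqrt _ in deltaE.
have Tr : T%:R = r ^+ 2 :> R by rewrite sqr_sqrtr.
have r0 : 0 < r by rewrite sqrtr_gt0 ltr0n.
have r1 : 1 <= r by rewrite -sqrtr1 ler_wsqrtr// ler1n.
have S20 : 0 <= S2 by apply: le_trans S2N.
pose kappa := 2 * B * D * d%:R.
have k0 : 0 <= kappa by rewrite !mulr_ge0// ltW.
have epsE : eps = kappa * T%:R^-1 by rewrite /eps /kappa; field; rewrite pnatr_eq0 -lt0n.
have BD0 : 0 <= B * D by rewrite mulr_ge0// ltW.
have bc := bias_constant_ge0 d L0 (ltW D0) (ltW B0).
have sum_err : \sum_(1 <= t < T.+1) (2 * eps +
      B * D * (6 * delta t + 4 * (3 * delta t + 2 * eps * `|L0|))) <=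
    bias_constant d D B L0 * (c * (lam * (2 * r))).
  apply: (@le_trans _ _ (\sum_(1 <= t < T.+1) bias_constant d D B L0 * delta t)).
    rewrite big_nat [leRHS]big_nat; apply: ler_sum => t tT.
    have le_eps : eps <= kappa * delta t by rewrite epsE ler_wpM2l// T_delta.
    have h : B * D * `|L0| * eps <= B * D * `|L0| * (kappa * delta t).
      by rewrite ler_wpM2l// mulr_ge0.
    by rewrite /bias_constant -/kappa; lra.
  rewrite -mulr_sumr ler_wpM2l//.
  under eq_bigr do rewrite deltaE.
  rewrite -!mulr_sumr ler_wpM2l ?sqrtr_ge0// ler_wpM2l//.
  exact: sum_invsqrt_le.
(* The step size balances the initial-distance and squared-gradient terms: both carry the factor
   $DB\sqrt T/2$, and [N] is at most [S2]. *)
have etaE : N%:R * D ^+ 2 / (2 * eta) = N%:R * (D * B * r / 2).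
  by rewrite /eta; field; rewrite !gt_eqF.
have etaE' : eta / 2 * T%:R * B ^+ 2 * S2 = D * B * r / 2 * S2.
  by rewrite /eta Tr; field; rewrite !gt_eqF.
have h1 : N%:R * (D * B * r / 2) <= S2 * (D * B * r / 2).
  by rewrite ler_wpM2r// divr_ge0// !mulr_ge0// ltW.
have h2 : N%:R * D ^+ 2 <= D ^+ 2 * r * S2.
  apply: (@le_trans _ _ (D ^+ 2 * S2)); first by rewrite mulrC ler_wpM2l ?sqr_ge0.
  by apply: (ler_wpM2r S20); rewrite ler_peMr// sqr_ge0.
have h3 := ler_wpM2l S10 sum_err.
have {}SE : S <= D ^+ 2 * r * S2 + m^-1 * (D * B * r * S2 +
    S1 * (bias_constant d D B L0 * (c * (lam * (2 * r))))).
  apply: (le_trans SE); rewrite etaE etaE'; apply: (lerD h2).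
  have mi : 0 <= m^-1 by rewrite invr_ge0 ltW.
  by apply: (ler_wpM2l mi); lra.
have e : D ^+ 2 * r * S2 + m^-1 * (D * B * r * S2 +
    S1 * (bias_constant d D B L0 * (c * (lam * (2 * r))))) =
    r * ((D ^+ 2 + D * B / m) * S2 + 2 * bias_constant d D B L0 * c / m * (lam * S1)).
  by field; rewrite gt_eqF.
rewrite e in SE.
rewrite Tr ler_pdivrMl ?exprn_gt0//.
apply: (le_trans SE).
have -> : r ^+ 2 * (rate_constant N d D B m L0 * (r^-1 * (S2 + lam * S1))) =
   r * (rate_constant N d D B m L0 * (S2 + lam * S1)).
  by field; rewrite gt_eqF.
rewrite ler_wpM2l ?(ltW r0)// /rate_constant -/c.
have : 0 <= D ^+ 2 + D * B / m.
  by rewrite addr_ge0 ?sqr_ge0// divr_ge0 ?mulr_ge0 ?ltW.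
have : 0 <= 2 * bias_constant d D B L0 * c / m.
  by rewrite divr_ge0 ?mulr_ge0 ?sqrtr_ge0// ltW.
have : 0 <= lam * S1 by rewrite mulr_ge0.
move: (D ^+ 2 + _) (2 * _ * _ / m) (lam * S1) => u v w w0 v0 u0.
by have := mulr_ge0 u0 w0; have := mulr_ge0 v0 S20; lra.
Qed.

End average.

Lemma le_expectation_split {R : realType} {disp : measure_display}
    {Omega : measurableType disp} (P : probability Omega R)
    (V : Omega -> R) (G : set Omega) (b c e : R) :
  measurable_fun setT V -> measurable G -> 0 <= b -> 0 <= c ->
  ((1 - e)%:E <= P G)%E -> (forall w, 0 <= V w <= c) ->
  (forall w, G w -> V w <= b) ->
  (\int[P]_w (V w)%:E <= (b + c * e)%:E)%E.
Proof.
move=> mV mG b0 c0 PG Vc Vb.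
have mGC : measurable (~` G) by exact: measurableC.
apply: (@le_trans _ _ (\int[P]_w (b + c * \1_(~` G) w)%:E)%E).
  apply: ge0_le_integral => //.
  - by move=> w _; rewrite lee_fin; case/andP: (Vc w).
  - exact/measurable_EFinP.
  - apply/measurable_EFinP; apply: measurable_funD => //.
    by apply: measurable_funM => //; exact: measurable_indic.
  - move=> w _; rewrite lee_fin indicE.
    have [Gw|nGw] := pselect (G w).
      by rewrite (le_trans (Vb w Gw))// lerDl mulr_ge0.
    rewrite mem_set// mulr1; case/andP: (Vc w) => _ /le_trans; apply.
    by rewrite lerDr.
under eq_integral do rewrite EFinD EFinM.
rewrite ge0_integralD//; last 2 first.
- by move=> w _; rewrite -EFinM lee_fin mulr_ge0.
- by apply: measurable_funeM; apply/measurable_EFinP; exact: measurable_indic.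
rewrite integral_cst//; have /= -> := probability_setT P.
rewrite mule1 ge0_integralZl_EFin//; last first.
  by apply/measurable_EFinP; exact: measurable_indic.
rewrite integral_indic// setIT EFinD leeD2l// EFinM lee_wpmul2l// ?lee_fin//.
have := probability_setC P mG => /= ->.
have Gfin : P G \is a fin_num by exact: fin_num_measure.
move: PG; rewrite -(fineK Gfin) lee_fin -EFinB lee_fin; lra.
Qed.

Section rate.
Context {R : realType} {N d nxi : nat} (D B m L0 p : R).
Context {disp : measure_display} {Omega : measurableType disp}.
Variables (P : probability Omega R) (X : 'I_N -> set 'rV[R]_d).
Variables (Xi : 'I_N -> set (nxi.-tuple R)) (xi : 'I_N -> {RV P >-> nxi.-tuple R}).
Variables (J : 'I_N -> 'M[R]_(N, d) -> nxi.-tuple R -> R).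
Variables (f : 'I_N -> 'rV[R]_d -> nxi.-tuple R -> R).
Variables (g : 'I_N -> 'M[R]_(N, d) -> R) (alpha : 'I_N -> R).
Variable xstar : 'M[R]_(N, d).
Hypothesis alpha01 : forall i, 0 < alpha i <= 1.
Hypothesis setting : game_setting D X Xi xi J.
Hypothesis decomposition : decomposable_monotone m X Xi xi J alpha f g.
Hypothesis gradients : bounded_gradients B X Xi J.
Hypothesis regular : regular_distributions L0 p X Xi xi J.
Hypothesis nash_xstar :
  nash X (fun i y => CVaR P (alpha i) (fun w => J i y (xi i w))) xstar.
Hypothesis B_gt0 : 0 < B.
Hypothesis m_gt0 : 0 < m.
Variables (T : nat) (x1 : 'M[R]_(N, d)).
Variables (s : 'I_N -> nat -> {RV P >-> nxi.-tuple R}).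
Variable x : nat -> Omega -> 'M[R]_(N, d).
Hypothesis iid : iid_samples Xi xi T s.
Hypothesis run : risk_averse_run X J alpha (D / B * (Num.sqrt T%:R)^-1) T x1 s x.

Let S1 := \sum_i (alpha i)^-1.
Let S2 := \sum_i (alpha i) ^- 2.

Let S1_ge0 : 0 <= S1.
Proof.
by apply: sumr_ge0 => i _; rewrite invr_ge0 ltW//; case/andP: (alpha01 i).
Qed.

Lemma agents_le_sum_sqr : N%:R <= S2.
Proof.
rewrite -[leLHS](_ : \sum_(i < N) 1 = _); last by rewrite sumr_const card_ord.
apply: ler_sum => i _; have /andP[a0 a1] := alpha01 i.
by rewrite invf_ge1 ?exprn_gt0// exprn_ile1// ltW.
Qed.

Lemma joint_iterate t w : (1 <= t < T.+1)%N -> joint X (x t w).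
Proof.
case: run => Xx1 [x1E [step _]].
elim: t => // -[|t] IH /andP[_ tT] i; first by rewrite x1E.
by have [] := step t.+1 i w tT.
Qed.

Lemma high_probability_rate (gamma : R) : 0 < D -> (1 < T)%N -> 0 < gamma < 1 ->
  exists G : set Omega, [/\ measurable G, ((1 - gamma)%:E <= P G)%E &
    forall w, G w ->
      T%:R^-1 * \sum_(1 <= t < T.+1) norm2 (x t w - xstar) ^+ 2 <=
      rate_constant N d D B m L0 * ((Num.sqrt T%:R)^-1 *
        (S2 + Num.sqrt (ln (T%:R / gamma)) * S1))].
Proof.
move=> D_gt0 T_gt1 /andP[gamma_gt0 gamma_lt1].
have T_gt0 : (0 < T)%N by exact: ltnW.
have TR_gt0 : 0 < T%:R :> R by rewrite ltr0n.
set Lam := ln (T%:R / gamma).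
have Tg_gt0 : 0 < T%:R / gamma by rewrite divr_gt0.
have Lam_ge : 2^-1 <= Lam.
  apply: (le_trans ln2_ge_half); rewrite ler_ln ?posrE//.
  rewrite ler_pdivlMr// (@le_trans _ _ 2)//; last by rewrite ler_nat.
  by rewrite ler_piMr// ltW.
have Lam_ge0 : 0 <= Lam by apply: le_trans Lam_ge.
pose K := (N + 2 * d + 4)%N.
(* Chosen so that $t\delta_t^2/8=K\ln(T/\gamma)$: a single event then deviates with probability at
   most $2(\gamma/T)^K$. *)
pose delta t := Num.sqrt (8 * K%:R) * (Num.sqrt Lam * (Num.sqrt t%:R)^-1) : R.
have K8 : 0 <= 8 * K%:R :> R by rewrite mulr_ge0.
(* It follows that $\delta_t\ge t^{-1/2}\ge1/T$, so that [T] levels and a net of spacing of order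
   $1/T$ are fine enough. *)
have KL : 1 <= Num.sqrt (8 * K%:R) * Num.sqrt Lam.
  rewrite -sqrtrM// -[leLHS]sqrtr1 ler_wsqrtr//.
  have : 4 <= K%:R :> R by rewrite (ler_nat R 4) leq_addl.
  nra.
have sqrt_gt0 t : (1 <= t < T.+1)%N -> 0 < Num.sqrt t%:R :> R.
  by case/andP=> t1 _; rewrite sqrtr_gt0 ltr0n.
have T_delta t : (1 <= t < T.+1)%N -> T%:R^-1 <= delta t.
  move=> tT; apply: (@le_trans _ _ (Num.sqrt t%:R)^-1).
    rewrite lef_pV2 ?posrE//; last exact: sqrt_gt0.
    have T1 : 1 <= T%:R :> R by rewrite ler1n.
    apply: (@le_trans _ _ (Num.sqrt T%:R)).
      by rewrite ler_wsqrtr// ler_nat; case/andP: tT.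
    have sT1 : 1 <= Num.sqrt T%:R :> R by rewrite -[leLHS]sqrtr1 ler_wsqrtr.
    by rewrite -[leRHS]sqr_sqrtr ?ler0n// expr2 ler_peMr// sqrtr_ge0.
  by rewrite /delta mulrA ler_peMl// invr_ge0 sqrtr_ge0.
have delta_gt0 t : (1 <= t < T.+1)%N -> 0 < delta t.
  by move=> tT; apply: lt_le_trans (T_delta t tT); rewrite invr_gt0.
have diam i u v : X i u -> X i v -> norm2 (u - v) <= D.
  by case: setting => _ [+ _]; apply.
have Xs i : X i (row i xstar) by case: nash_xstar => + _; apply.
have net i := finite_net D_gt0 T_gt0 (Xs i) (diam i).
pose rep i := sval (cid (net i)).
have X_rep i c : X i (rep i c) by case: (svalP (cid (net i))) => + _; apply.
have rep_near i u : X i u ->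
    exists c, norm2 (u - rep i c) <= d%:R * (2 * D / T%:R).
  by case: (svalP (cid (net i))) => _; apply.
pose eps := B * (d%:R * (2 * D / T%:R)).
pose A i t (a : {ffun 'I_d -> 'I_T.+1} * ('I_T + option bool)) :=
  test_event P (xi i) (Xi i) (alpha i) (B * D) eps (delta t)
    (anchored J xstar i (rep i a.1)) (anchored J xstar i (row i xstar)) a.2.
have mA i t a : measurable (A i t a).
  apply: measurable_test_event.
  - by case: setting => _ [_ [+ _]]; apply.
  - exact: (measurable_anchored setting nash_xstar (X_rep i a.1)).
  - exact: (measurable_anchored setting nash_xstar (Xs i)).
pose e := 2 * (gamma / T%:R) ^+ K.
have small t : (1 <= t < T.+1)%N ->
    2 * expR (- (t%:R * delta t ^+ 2 / 8)) <= e.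
  move=> tT; rewrite /e ler_pM2l// /delta !exprMn !sqr_sqrtr// exprVn sqr_sqrtr//.
  rewrite (_ : _ / 8 = K%:R * Lam); last first.
    by field; rewrite pnatr_eq0 -lt0n; case/andP: tT.
  rewrite -mulrN expRM_natl -exprMn lerXn2r ?nnegrE ?expR_ge0 ?divr_ge0 ?(ltW gamma_gt0)//.
  by rewrite expRN lnK ?posrE// invf_div.
have [G [mG PG Gdev]] := uniform_deviation iid mA delta_gt0 small.
exists G; split => //.
  apply: le_trans PG; rewrite lee_fin lerD2l lerN2.
  rewrite card_prod card_ffun !card_ord card_sum card_option card_bool card_ord.
  rewrite /e mulrA -[2]/(2%:R) -natrM.
  apply: (@le_trans _ _ ((T ^ K)%:R * (gamma / T%:R) ^+ K)).
    rewrite ler_wpM2r ?exprn_ge0 ?divr_ge0 ?(ltW gamma_gt0)// ler_nat.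
    exact: card_events_le.
  rewrite natrX -exprMn mulrC divfK ?gt_eqF//.
  by rewrite /K addn4 exprS ler_piMr ?exprn_ile1 ?ltW.
move=> w Gw; have [Xx1 [x1E [step _]]] := run.
apply: (average_rate (lam := Num.sqrt Lam) (delta := delta) (d := d) D_gt0 B_gt0
  m_gt0 T_gt0 S1_ge0 agents_le_sum_sqr) => //.
apply: (regret_bound alpha01 setting decomposition gradients regular nash_xstar
  B_gt0 m_gt0 D_gt0 T_gt0 (z := fun i k => s i k w) (x := fun t => x t w)
  _ _ _ _ delta_gt0 T_delta X_rep rep_near).
- by rewrite !mulr_gt0 ?invr_gt0// sqrtr_gt0.
- by move=> i k kT; have [_ law] := iid i; case: (law k kT).
- by rewrite x1E.
- by move=> t i tT; exact: step.
- by move=> i t c ty tT; exact: (Gdev w i t (c, ty) Gw tT).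
Qed.

Lemma average_distance_le w : (0 < T)%N ->
  0 <= T%:R^-1 * \sum_(1 <= t < T.+1) norm2 (x t w - xstar) ^+ 2 <= N%:R * D ^+ 2.
Proof.
move=> T0; have TR0 : 0 < T%:R :> R by rewrite ltr0n.
apply/andP; split.
  by rewrite mulr_ge0 ?invr_ge0//; apply: sumr_ge0 => t _; rewrite sqr_ge0.
rewrite ler_pdivrMl//.
apply: (@le_trans _ _ (\sum_(1 <= t < T.+1) N%:R * D ^+ 2)); last first.
  by rewrite sumr_const_nat subn1/= [leRHS]mulr_natl.
rewrite big_nat [leRHS]big_nat; apply: ler_sum => t tT.
exact: (dist_joint_le setting nash_xstar (joint_iterate w tT)).
Qed.

Lemma measurable_distance t : (1 <= t < T.+1)%N ->
  measurable_fun setT (fun w => norm2 (x t w - xstar) ^+ 2).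
Proof.
move=> tT; case: run => _ [_ [_ mx]].
under eq_fun do rewrite sqr_norm2 /dotp.
apply: (@measurable_sum _ _ _ _ _ _
  (fun i w => \sum_j (x t w - xstar) i j * (x t w - xstar) i j)) => i.
apply: (@measurable_sum _ _ _ _ _ _
  (fun j w => (x t w - xstar) i j * (x t w - xstar) i j)) => j.
have mij : measurable_fun setT (fun w => (x t w - xstar) i j).
  under eq_fun do rewrite !mxE; apply: measurable_funB => //.
  by apply: mx; case/andP: tT => ->.
exact: measurable_funM.
Qed.

Lemma measurable_average_distance : measurable_fun setT
  (fun w => T%:R^-1 * \sum_(1 <= t < T.+1) norm2 (x t w - xstar) ^+ 2).
Proof.
apply: measurable_funM => //.
under eq_fun do rewrite big_add1 big_mkord.
apply: (@measurable_sum _ _ _ _ _ _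
  (fun (t : 'I_T) w => norm2 (x t.+1 w - xstar) ^+ 2)) => t.
by apply: measurable_distance; exact: ltn_ord.
Qed.

Lemma average_expectation :
  ((T%:R^-1)%:E *
   \sum_(1 <= t < T.+1) 'E_P[fun w => (norm2 (x t w - xstar) ^+ 2)%R] =
   \int[P]_w (T%:R^-1 * \sum_(1 <= t < T.+1) norm2 (x t w - xstar) ^+ 2)%R%:E)%E.
Proof.
rewrite big_add1 big_mkord/=.
under [RHS]eq_integral do rewrite big_add1 big_mkord/= EFinM -sumEFin.
have mY (t : 'I_T) : measurable_fun setT
    (fun w => (norm2 (x t.+1 w - xstar) ^+ 2)%:E).
  by apply/measurable_EFinP; apply: measurable_distance; exact: ltn_ord.
rewrite ge0_integralZl_EFin ?invr_ge0//; last 2 first.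
- by move=> w _; apply: sume_ge0 => t _; rewrite lee_fin sqr_ge0.
- by apply: emeasurable_sum => t.
rewrite ge0_integral_sum//; last by move=> t w _; rewrite lee_fin sqr_ge0.
by congr (_ * _)%E; apply: eq_bigr => t _; rewrite unlock.
Qed.

End rate.

(** The informal claim attaches a probability to a bound on expectations; both readings, the
    pathwise average with high probability and the average of expectations, are proved with one
    constant. *)
Theorem theorem1 (R : realType) (N d : nat) (D B m L0 p : R)
    (B_gt0 : 0 < B) (m_gt0 : 0 < m) (p_gt0 : 0 < p) :
  exists C : R,
  forall (nxi : nat) (disp : measure_display) (Omega : measurableType disp)
    (P : probability Omega R)
    (X : 'I_N -> set 'rV[R]_d) (Xi : 'I_N -> set (nxi.-tuple R))
    (xi : 'I_N -> {RV P >-> nxi.-tuple R})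
    (J : 'I_N -> 'M[R]_(N, d) -> nxi.-tuple R -> R)
    (f : 'I_N -> 'rV[R]_d -> nxi.-tuple R -> R)
    (g : 'I_N -> 'M[R]_(N, d) -> R)
    (alpha : 'I_N -> R) (xstar : 'M[R]_(N, d))
    (T : nat) (gamma : R) (x1 : 'M[R]_(N, d))
    (s : 'I_N -> nat -> {RV P >-> nxi.-tuple R})
    (x : nat -> Omega -> 'M[R]_(N, d)),
  (forall i, 0 < alpha i <= 1) ->
  game_setting D X Xi xi J ->
  decomposable_monotone m X Xi xi J alpha f g ->
  bounded_gradients B X Xi J ->
  regular_distributions L0 p X Xi xi J ->
  nash X (fun i y => CVaR P (alpha i) (fun w => J i y (xi i w))) xstar ->
  (0 < T)%N ->
  0 < gamma < 1 ->
  iid_samples Xi xi T s ->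
  risk_averse_run X J alpha (D / B * (Num.sqrt T%:R)^-1) T x1 s x ->
  let S1 := \sum_i (alpha i)^-1 in
  let S2 := \sum_i (alpha i) ^- 2 in
  let bound :=
    C * ((Num.sqrt T%:R)^-1 * (S2 + Num.sqrt (ln (T%:R / gamma)) * S1)) in
  ((1 - gamma)%:E <=
     P [set w | (T%:R^-1 * \sum_(1 <= t < T.+1) norm2 (x t w - xstar) ^+ 2
                 <= bound)%R])%E /\
  ((T%:R^-1)%:E *
     \sum_(1 <= t < T.+1) 'E_P[fun w => (norm2 (x t w - xstar) ^+ 2)%R]
   <= bound%:E)%E.
Proof.
(* The constant is chosen before anything forces [D] to be positive, hence the absolute value. *)
pose C1 := rate_constant N d `|D| B m L0.
have C1_ge0 : 0 <= C1 by apply: rate_constant_ge0 => //; exact: ltW.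
(* The 2 pays for replacing $\gamma$ by $1/T$ in the logarithm, and [D ^+ 2] for the exceptional
   event and for the case [T = 1]. *)
exists (2 * C1 + D ^+ 2).
move=> nxi disp Omega P X Xi xi J f g alpha xstar T gamma x1 s x.
move=> alpha01 setting decomposition gradients regular nash_xstar T_gt0 gamma01.
move=> iid run S1 S2 bound.
have TR_gt0 : 0 < T%:R :> R by rewrite ltr0n.
have TR_ge1 : 1 <= T%:R :> R by rewrite ler1n.
have S2N : N%:R <= S2 by exact: agents_le_sum_sqr.
have S1_ge0 : 0 <= S1.
  by apply: sumr_ge0 => i _; rewrite invr_ge0 ltW//; case/andP: (alpha01 i).
have r_gt0 : 0 < Num.sqrt T%:R :> R by rewrite sqrtr_gt0.
have ri_ge0 : 0 <= (Num.sqrt T%:R)^-1 :> R by rewrite invr_ge0 ltW.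
pose rate (lam : R) := (Num.sqrt T%:R)^-1 * (S2 + Num.sqrt lam * S1).
have S2_ge0 : 0 <= S2 by apply: le_trans S2N.
have rate_ge0 lam : 0 <= rate lam.
  by rewrite mulr_ge0// addr_ge0// mulr_ge0// sqrtr_ge0.
have boundE : bound = (2 * C1 + D ^+ 2) * rate (ln (T%:R / gamma)) by [].
have avg_le w := average_distance_le setting nash_xstar run w T_gt0.
have mavg := measurable_average_distance xstar run.
have prob_ge (G : set Omega) : measurable G -> ((1 - gamma)%:E <= P G)%E ->
    (forall w, G w -> T%:R^-1 *
      \sum_(1 <= t < T.+1) norm2 (x t w - xstar) ^+ 2 <= bound) ->
    ((1 - gamma)%:E <= P [set w | (T%:R^-1 *
      \sum_(1 <= t < T.+1) norm2 (x t w - xstar) ^+ 2 <= bound)%R])%E.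
  move=> mG PG Gb; apply: (le_trans PG); apply: le_measure; rewrite ?inE//.
  by rewrite -[X in measurable X]setTI; apply: measurable_fun_le.
rewrite (average_expectation xstar run).
have ND_ge0 : 0 <= N%:R * D ^+ 2 by rewrite mulr_ge0// sqr_ge0.
have /andP[gamma_gt0 gamma_lt1] := gamma01.
have trivial_case : N%:R * D ^+ 2 <= bound ->
    ((1 - gamma)%:E <= P [set w | (T%:R^-1 *
      \sum_(1 <= t < T.+1) norm2 (x t w - xstar) ^+ 2 <= bound)%R])%E /\
    (\int[P]_w (T%:R^-1 * \sum_(1 <= t < T.+1) norm2 (x t w - xstar) ^+ 2)%R%:E
      <= bound%:E)%E.
  move=> NDb; have avg_b w : T%:R^-1 *
      \sum_(1 <= t < T.+1) norm2 (x t w - xstar) ^+ 2 <= bound.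
    by apply: le_trans NDb; case/andP: (avg_le w).
  split.
    apply: (prob_ge setT) => //.
    by rewrite probability_setT lee_fin lerBlDr lerDl ltW.
  rewrite -[bound]addr0 -[X in bound + X](mulr0 (N%:R * D ^+ 2)).
  apply: (le_expectation_split (G := setT)) => //.
  - exact: le_trans NDb.
  - by rewrite probability_setT subr0.
have bound_ge0 : 0 <= bound.
  by rewrite boundE mulr_ge0// addr_ge0 ?sqr_ge0// mulr_ge0.
(* Without agents or with [D = 0] all distances vanish; otherwise some action set is inhabited by an
   equilibrium action, which makes [D] positive. *)
have [ND0|ND_neq0] := eqVneq (N%:R * D ^+ 2) 0.
  by apply: trivial_case; rewrite ND0.
(* [high_probability_rate] needs [T] at least 2; for a single episode the rate is at least [S2],
   hence at least [N], and the diameter bound suffices. *)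
have [T1|T_neq1] := eqVneq T 1%N.
  apply: trivial_case; rewrite boundE /rate T1 sqrtr1 invr1 mul1r.
  apply: (@le_trans _ _ (D ^+ 2 * S2)); first by rewrite mulrC ler_wpM2l ?sqr_ge0.
  have : 0 <= Num.sqrt (ln (1 / gamma)) * S1 by rewrite mulr_ge0// sqrtr_ge0.
  move: (_ * S1) => q q0; rewrite mulrDl.
  have : 0 <= 2 * C1 * (S2 + q) by rewrite !mulr_ge0// addr_ge0.
  have : 0 <= D ^+ 2 * q by rewrite mulr_ge0// sqr_ge0.
  lra.
have T_gt1 : (1 < T)%N by rewrite ltn_neqAle eq_sym T_neq1.
have D_gt0 : 0 < D.
  rewrite lt_def; move: ND_neq0; rewrite mulf_eq0 negb_or sqrf_eq0.
  move=> /andP[N0 ->] /=; have i : 'I_N.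
    by case: (N) N0 => [|k]; [rewrite eqxx|move=> _; exact: ord0].
  case: setting => _ [diam _]; case: nash_xstar => Xs _.
  exact: le_trans (norm2_ge0 _) (diam i _ _ (Xs i) (Xs i)).
have high gam := @high_probability_rate R N d nxi D B m L0 p disp Omega P X Xi xi
  J f g alpha xstar alpha01 setting decomposition gradients regular nash_xstar
  B_gt0 m_gt0 T x1 s x iid run gam D_gt0 T_gt1.
have C1E : C1 = rate_constant N d D B m L0 by rewrite /C1 gtr0_norm.
rewrite -C1E in high; split.
  have [G [mG PG Gb]] := high _ gamma01.
  apply: (prob_ge G) => // w /Gb/le_trans; apply.
  rewrite boundE -/S1 -/S2 -/(rate _) ler_wpM2r//.
  by have := sqr_ge0 D; move: C1_ge0; lra.
(* The expectation is split along the event of probability [1 - 1 / T]. *)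
have Ti_lt1 : T%:R^-1 < 1 :> R by rewrite invf_lt1// ltr1n.
have Ti01 : 0 < (T%:R^-1 : R) < 1.
  by apply/andP; split; [rewrite invr_gt0|exact: Ti_lt1].
have [G [mG PG Gb]] := high _ Ti01.
apply: (le_trans (le_expectation_split mavg mG _ ND_ge0 PG avg_le Gb)).
  by rewrite mulr_ge0// mulr_ge0// addr_ge0// mulr_ge0// sqrtr_ge0.
rewrite lee_fin boundE -/S1 -/S2 -/(rate _).
have lnT_ge0 : 0 <= ln (T%:R / gamma).
  by apply: ln_ge0; rewrite ler_pdivlMr// mul1r (le_trans (ltW gamma_lt1)).
(* At level $1/T$ the logarithm is $\ln T^2=2\ln T\le2\ln(T/\gamma)$. *)
have rate_le : rate (ln (T%:R / T%:R^-1)) <= 2 * rate (ln (T%:R / gamma)).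
  have sqrt_le : Num.sqrt (ln (T%:R / T%:R^-1)) <= 2 * Num.sqrt (ln (T%:R / gamma)).
    have -> : 2 = Num.sqrt (2 ^+ 2) :> R by rewrite sqrtr_sqr ger0_norm.
    rewrite -sqrtrM ?sqr_ge0// ler_wsqrtr// invrK -expr2 lnXn//.
    have : ln T%:R <= ln (T%:R / gamma).
      by rewrite ler_ln ?posrE ?divr_gt0// ler_pdivlMr// ler_piMr// ltW.
    by rewrite [X in _ -> X <= _]mulr2n; move: lnT_ge0; lra.
  rewrite /rate mulrCA ler_wpM2l// mulrDr mulrA lerD//.
    by rewrite ler_peMl// ler1n.
  exact: ler_wpM2r.
have ND_le : N%:R * D ^+ 2 * T%:R^-1 <= D ^+ 2 * rate (ln (T%:R / gamma)).
  rewrite mulrAC mulrC ler_wpM2l ?sqr_ge0//.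
  apply: (@le_trans _ _ ((Num.sqrt T%:R)^-1 * S2)); last first.
    by rewrite ler_wpM2l// lerDl mulr_ge0// sqrtr_ge0.
  rewrite mulrC; apply: ler_pM => //.
  rewrite lef_pV2 ?posrE// -[leRHS]sqr_sqrtr ?ler0n// expr2 ler_peMr ?sqrtr_ge0//.
  by rewrite -[leLHS]sqrtr1 ler_wsqrtr.
by have := ler_wpM2l C1_ge0 rate_le; lra.
Qed.
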